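(* There exists a polynomial-time algorithm $\mathcal{A}$ which, given an acyclic digraph $D=(V,A)$, either finds a non-separating out-branching of $D$ or finds a certificate that $D$ has no non-separating out-branching.
   Context: Digraphs are finite, and a digraph is acyclic if it has no directed cycle. An out-branching of a digraph $D=(V,A)$ (rooted at some vertex $s\in V$; the root is not prescribed) is a spanning subdigraph of $D$ whose underlying graph is a spanning tree and in which every vertex is reachable from $s$ by a directed path. A subdigraph $D'=(V,A')$ of a digraph $D=(V,A)$ is non-separating if the digraph $D^*=(V,A\setminus A')$ is connected, meaning that the underlying undirected graph of $D^*$ is connected. A certificate is a witness of non-existence that can be verified in polynomial time. *)

(* Defs.v *)
From mathcomp Require Import all_boot.

Set Implicit Arguments.
Unset Strict Implicit.
Unset Printing Implicit Defensive.

(** * Polynomial time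

    Computations are those of the WHILE language of N. D. Jones
    (Computability and Complexity from a Programming Perspective, 1997), an
    imperative language whose values are binary trees.  The cost model is a
    conservative one: evaluating an expression costs the size of the value of
    each of its subexpressions, so that a run of cost [t] never handles a tree
    larger than its input size plus [t].  The functions computable at
    polynomial cost are exactly those computable in polynomial time by Turing
    machines. *)

Inductive tree := Leaf | Node of tree & tree.

Fixpoint tsize (d : tree) : nat :=
  if d is Node a b then (tsize a + tsize b).+1 else 1.

Inductive expr :=
  | EVar of nat
  | ELeaf
  | ENode of expr & expr
  | ELeft of expr
  | ERight of expr.

Inductive cmd :=
  | Assign of nat & expr
  | Seq of cmd & cmd
  | If of expr & cmd & cmd
  | While of expr & cmd.

Definition store := nat -> tree.

Definition update (st : store) (x : nat) (d : tree) : store :=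
  fun y => if y == x then d else st y.

Definition left_child (d : tree) : tree := if d is Node a _ then a else Leaf.
Definition right_child (d : tree) : tree := if d is Node _ b then b else Leaf.

Fixpoint eval (st : store) (e : expr) : tree :=
  match e with
  | EVar x => st x
  | ELeaf => Leaf
  | ENode e1 e2 => Node (eval st e1) (eval st e2)
  | ELeft e1 => left_child (eval st e1)
  | ERight e1 => right_child (eval st e1)
  end.

Fixpoint ecost (st : store) (e : expr) : nat :=
  tsize (eval st e) +
  match e with
  | EVar _ | ELeaf => 0
  | ENode e1 e2 => ecost st e1 + ecost st e2
  | ELeft e1 | ERight e1 => ecost st e1
  end.

(** [exec c st st' t]: from the store [st], the command [c] halts in the store
    [st'] at cost [t].  In tests, [Leaf] is false and every [Node] is true. *)
Inductive exec : cmd -> store -> store -> nat -> Prop :=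
  | ExecAssign x e st :
      exec (Assign x e) st (update st x (eval st e)) (ecost st e).+1
  | ExecSeq c1 c2 st st1 st2 t1 t2 :
      exec c1 st st1 t1 -> exec c2 st1 st2 t2 ->
      exec (Seq c1 c2) st st2 (t1 + t2).+1
  | ExecIfTrue e c1 c2 st st1 t :
      eval st e <> Leaf -> exec c1 st st1 t ->
      exec (If e c1 c2) st st1 (ecost st e + t).+1
  | ExecIfFalse e c1 c2 st st1 t :
      eval st e = Leaf -> exec c2 st st1 t ->
      exec (If e c1 c2) st st1 (ecost st e + t).+1
  | ExecWhileTrue e c st st1 st2 t1 t2 :
      eval st e <> Leaf -> exec c st st1 t1 ->
      exec (While e c) st1 st2 t2 ->
      exec (While e c) st st2 (ecost st e + t1 + t2).+1
  | ExecWhileFalse e c st :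
      eval st e = Leaf -> exec (While e c) st st (ecost st e).+1.

(** Variable [0] holds the input and the output; all other variables are
    initially [Leaf]. *)
Definition runs (p : cmd) (d d' : tree) (t : nat) : Prop :=
  exists2 st : store, exec p (update (fun=> Leaf) 0 d) st t & st 0 = d'.

Definition polytime (f : tree -> tree) : Prop :=
  exists (p : cmd) (a k : nat), forall d : tree,
  exists2 t : nat, runs p d (f d) t & t <= a * tsize d ^ k.

(** * Digraphs

    A digraph with vertex set [V] is given by its set of arcs. *)

Definition digraph (V : finType) := {set V * V}.

Definition arc (V : finType) (A : digraph V) : rel V :=
  [rel x y | (x, y) \in A].

Definition uarc (V : finType) (A : digraph V) : rel V :=
  [rel x y | ((x, y) \in A) || ((y, x) \in A)].

Definition acyclic (V : finType) (A : digraph V) : Prop :=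
  forall c : seq V, ucycle (arc A) c -> c = [::].

Definition connected (V : finType) (A : digraph V) : Prop :=
  forall x y : V, connect (uarc A) x y.

(** The first condition excludes the cycles of length 1 and 2 of the underlying
    multigraph (loops and pairs of opposite arcs); the second one excludes the
    longer ones.  Note that a single edge [xy] gives [ucycle (uarc A) [:: x; y]],
    which is not a cycle of the underlying graph. *)
Definition underlying_acyclic (V : finType) (A : digraph V) : Prop :=
  (forall x y : V, (x, y) \in A -> (y, x) \notin A) /\
  (forall c : seq V, ucycle (uarc A) c -> size c <= 2).

Definition underlying_tree (V : finType) (A : digraph V) : Prop :=
  connected A /\ underlying_acyclic A.

Definition out_branching (V : finType) (A B : digraph V) : Prop :=
  [/\ B \subset A,
      underlying_tree B
    & exists s : V, forall v : V, connect (arc B) s v].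

Definition non_separating (V : finType) (A B : digraph V) : Prop :=
  connected (A :\: B).

Definition nonsep_out_branching (V : finType) (A B : digraph V) : Prop :=
  out_branching A B /\ non_separating A B.

(** * Encodings and certificates *)

Definition tree_of_bool (b : bool) : tree := if b then Node Leaf Leaf else Leaf.

Definition tree_of_seq (s : seq tree) : tree := foldr Node Leaf s.

(** The adjacency matrix, as the list of its rows, with respect to the
    enumeration of [V]. *)
Definition encode (V : finType) (A : digraph V) : tree :=
  tree_of_seq
    [seq tree_of_seq [seq tree_of_bool ((x, y) \in A) | y <- enum V]
       | x <- enum V].

(** The verifier [ver] accepts [c] as a certificate for the digraph [A]. *)
Definition accepts (ver : tree -> tree) (V : finType) (A : digraph V)
    (c : tree) : Prop :=
  ver (Node (encode A) c) <> Leaf.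

Definition nonexistence_verifier (ver : tree -> tree) : Prop :=
  polytime ver /\
  forall (V : finType) (A : digraph V) (c : tree),
    acyclic A -> accepts ver A c ->
    ~ exists B : digraph V, nonsep_out_branching A B.

(** The left child of an output tells which of the two kinds of answer the right
    child is. *)
Definition branching_answer (V : finType) (B : digraph V) : tree :=
  Node (tree_of_bool true) (encode B).

Definition certificate_answer (c : tree) : tree := Node (tree_of_bool false) c.

(* Main.v *)
Require Import Defs.
From mathcomp Require Import all_boot zify.
Import Defs.

Set Implicit Arguments.
Unset Strict Implicit.
Unset Printing Implicit Defensive.

(** In an acyclic digraph [A], the root of an out-branching has no entering arc and
    every other vertex has one, while walking backwards along arcs always ends in a
    vertex without entering arcs.  Hence [A] has an out-branching only if exactly
    one vertex [s] has no entering arc, and then its out-branchings are exactly the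
    sets with one arc into each vertex other than [s] ([branching_spec],
    [choice_branching]).  Such a set [B] is non-separating if and only if
    [A :\: B] is connected, that is, if [B] is independent in the cographic
    matroid of a connected [A].  The question is thus whether the families of
    arcs entering the vertices other than [s] have an independent transversal, as
    in Rado's theorem, and it is answered by augmenting paths.

    The search maintains a [partial_choice]: an independent set [B] of arcs with at
    most one arc into each vertex.  A vertex is [exposed] if an arc into it can be
    added to [B], and [x] is joined to [w] by an [exchange] if an arc into [x] can
    replace the arc of [B] into [w].  Take a shortest path of exchanges from an
    [unmet] vertex to an exposed vertex [w], and give [w] the arc that exposes it,
    in place of its arc in [B] if there is one.  If [w] is unmet, this meets it.
    Otherwise the predecessor of [w] becomes exposed and the earlier part of the
    path survives ([exchange_augment]), so that the distance has dropped
    ([hit_sooner]).  Therefore at most [#|V|] steps meet one more vertex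
    ([progress]), and [#|V|] rounds of [#|V|] steps suffice ([solve_stuck]).

    If unmet vertices remain but no exposed vertex can be reached from them, let
    [S] be the set of the vertices that can be reached.  The arcs of [B] into [S]
    are fewer than [#|S|], and no other arc into [S] can be added to them without
    losing independence; but the arcs into [S] of a non-separating out-branching
    would be [#|S|] independent arcs, contradicting the augmentation property of
    matroids ([stuck_optimal]).  This property, [indep_augment], is all that the
    proof takes from matroid theory besides heredity ([indepS]).  Since the search
    decides the question, a certificate does not have to carry any information: the
    verifier repeats the search.

    For the running time, one first shows that the functions computed by
    programs in polynomial time are closed under composition, pairing, tests and
    loops over a list whose accumulator stays of polynomial size
    ([ptime_foldl]).  All the objects of the search are defined from [A] by
    boolean connectives, quantification over the vertices, comprehension, and
    [#|V|]-fold iteration of an operation on sets of vertices or on sets of arcs.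
    Whatever is defined in this way is computed in polynomial time from the
    adjacency matrix (the lemmas on [feasible]), which is the easy half of the
    logical characterisation of polynomial time by fixed points: a quantifier is
    a loop over the vertices, and the size of the code of a set is bounded in terms
    of the number of vertices. *)

(** * Exchange between connected digraphs *)

Section Connectivity.
Variable V : finType.
Implicit Types (E B I J : digraph V) (x y z : V).

(** After [k] rounds this contains the pairs joined by an undirected path with less
    than [k] edges.  Reachability is obtained as a [#|V|]-fold iteration in order
    to fit [feasible_iter]. *)
Definition uclosure E : digraph V :=
  iter #|V| (fun R : digraph V => [set p | (p.1 == p.2) ||
    [exists z, ((p.1, z) \in R) && (((z, p.2) \in E) || ((p.2, z) \in E))]]) (set0 : digraph V).

Lemma uclosureE E x y : ((x, y) \in uclosure E) = connect (uarc E) x y.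
Proof.
pose R k := iter k (fun R : digraph V => [set p | (p.1 == p.2) ||
    [exists z, ((p.1, z) \in R) && (((z, p.2) \in E) || ((p.2, z) \in E))]]) (set0 : digraph V).
have RP k u v : reflect (exists p, [/\ path (uarc E) u p, v = last u p & size p < k])
    ((u, v) \in R k).
  elim: k v => [|k IH] v; first by rewrite inE; constructor; case=> p [].
  rewrite /R iterS -/(R k) inE /=; apply: (iffP orP).
    case=> [/eqP <- | /existsP[z /andP[/IH[p [pp zp sp]] zv]]]; first by exists [::].
    by exists (rcons p v); rewrite rcons_path pp -zp last_rcons size_rcons.
  case=> p; case/lastP: p => [|p w] [] /=; first by move=> _ ->; left.
  rewrite rcons_path last_rcons size_rcons ltnS => /andP[pp pw] -> sp; right.
  by apply/existsP; exists (last u p); apply/andP; split=> //; apply/IH; exists p.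
apply/(RP #|V|)/connectP => [[p [pp -> _]] | [p pp ->]]; first by exists p.
case/shortenP: pp => q pq uq _; exists q; split=> //.
by have := max_card (mem (x :: q)); rewrite (card_uniqP uq).
Qed.

Definition connectedb E : bool := [forall x, [forall y, (x, y) \in uclosure E]].

Lemma connectedP E : reflect (connected E) (connectedb E).
Proof.
apply: (iffP forallP) => [cE x y | cE x].
  by move/forallP: (cE x) => /(_ y); rewrite uclosureE.
by apply/forallP => y; rewrite uclosureE.
Qed.

Lemma uarcE E x y : uarc E x y = ((x, y) \in E) || ((y, x) \in E).
Proof. by []. Qed.

Lemma uarc_sym E : connect_sym (uarc E).
Proof. by apply: sym_connect_sym => x y; rewrite !uarcE orbC. Qed.

Lemma connect_uarcS E E' : E \subset E' -> subrel (connect (uarc E)) (connect (uarc E')).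
Proof.
move=> /subsetP sE; apply: connect_sub => x y; rewrite uarcE => /orP[] /sE xy; apply: connect1;
  by rewrite uarcE xy ?orbT.
Qed.

Lemma connectedS E E' : E \subset E' -> connected E -> connected E'.
Proof. by move=> sE cE x y; apply: (connect_uarcS sE). Qed.

Lemma path_leaves (e : rel V) (a : pred V) x y :
  connect e x y -> a x -> ~~ a y -> exists u v, [/\ e u v, a u & ~~ a v].
Proof.
move=> /connectP[p pp ->] {y}; elim: p x pp => [|z p IH] x /=.
  by move=> _ ->.
move=> /andP[xz pz] ax nl; case az: (a z); first exact: IH pz az nl.
by exists x, z; rewrite az.
Qed.

(** If [E] falls apart without [i], it has exactly two pieces, each containing an
    end of [i], and the connected digraph [E'] has an arc between them. *)
Lemma connected_exchange E E' i : connected E -> connected E' ->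
  connected (E :\ i) \/ exists2 j, j \in E' & connected (j |: (E :\ i)).
Proof.
case: i => a b cE cE'; set F := E :\ (a, b).
(* a path to [a] in [E] is a path in [F] up to the first use of [(a, b)] *)
have side x : connect (uarc F) x a \/ connect (uarc F) x b.
  have /connectP[p pp pa] := cE x a.
  elim: p x pp pa => [|y p IH] x /=; first by move=> _ ->; left; apply: connect0.
  move=> /andP[xy /IH{}IH] /IH{}IH.
  have [xyF|] := boolP (uarc F x y).
    by case: IH => h; [left|right]; apply: connect_trans h; apply: connect1.
  rewrite uarcE /F !inE; move: xy; rewrite uarcE => /orP[] -> ; rewrite andbT negb_or.
    by rewrite negbK => /andP[/eqP[-> _] _]; left; apply: connect0.
  by rewrite negbK => /andP[_ /eqP[_ ->]]; right; apply: connect0.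
have glue G : connect (uarc G) a b -> F \subset G -> connected G.
  move=> ab FG; have toa x : connect (uarc G) x a.
    have [/(connect_uarcS FG)//|/(connect_uarcS FG) xb] := side x.
    by apply: connect_trans xb _; rewrite uarc_sym.
  by move=> x y; apply: connect_trans (toa x) _; rewrite uarc_sym.
have [ab|nab] := boolP (connect (uarc F) a b); first by left; apply: glue.
right; have [u [v [uv au nav]]] := path_leaves (a := connect (uarc F) a) (cE' a b) (connect0 _ a) nab.
have vb : connect (uarc F) v b.
  by case: (side v) => // va; case/negP: nav; rewrite uarc_sym.
suff H j : (j == (u, v)) || (j == (v, u)) -> connected (j |: F).
  by move: uv; rewrite uarcE => /orP[] uv; [exists (u, v) | exists (v, u)] => //; apply: H; rewrite eqxx ?orbT.
move=> jj; have FG : F \subset j |: F by apply: subsetUr.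
apply: glue (FG); apply: connect_trans (connect_uarcS FG au) _.
apply: connect_trans _ (connect_uarcS FG vb); apply: connect1.
by rewrite uarcE !inE; case/orP: jj => /eqP ->; rewrite eqxx ?orbT.
Qed.

End Connectivity.

Section Cographic.
Variables (V : finType) (A : digraph V).
Implicit Types (B I J : digraph V).

(** For connected [A], these are the independent sets of the cographic matroid. *)
Definition indep B : bool := connectedb (A :\: B).

Lemma indepS I J : I \subset J -> indep J -> indep I.
Proof. by move=> IJ /connectedP cJ; apply/connectedP/connectedS/cJ/setDS. Qed.

(** By induction on [#|I :\: J|]: an element [i] of [I] outside of [J] can be
    brought into [J] in exchange for an element [j] outside of [I], so that [J]
    keeps its size and comes closer to [I], until [I] is contained in [J]. *)
Lemma indep_augment I J : indep I -> indep J -> #|I| < #|J| ->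
  exists j, [/\ j \in J, j \notin I & indep (j |: I)].
Proof.
move=> iI; have [n] := ubnP #|I :\: J|; elim: n J => // n IH J lt_n iJ ltIJ.
have [j0 j0J j0I] : exists2 j, j \in J & j \notin I.
  apply/subsetPn; apply: contraL ltIJ => /subset_leq_card; lia.
have [IJ|] := boolP (I \subset J).
  exists j0; split=> //; apply: indepS iJ.
  by rewrite subUset sub1set j0J.
case/subsetPn => i iI' iJ'.
(* it remains to exchange [i] for some [j] *)
suff [j jJ [jI ij]] : exists2 j, j \in J & j \notin I /\ indep ((i |: J) :\ j).
  have ji : i != j by apply: contraNneq jI => <-.
  have [] := IH ((i |: J) :\ j); rewrite ?ij //.
  - apply: leq_trans (_ : #|(I :\: J) :\ i| < n); last first.
      by rewrite (cardsD1 i) !inE iI' iJ' add1n ltnS in lt_n.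
    rewrite ltnS; apply/subset_leq_card/subsetP => k; rewrite !inE.
    case: (k =P i) => [->|_]; first by rewrite ji.
    case: (k =P j) => [->|_] /=; first by rewrite (negbTE jI) andbF.
    by [].
  - have := cardsU1 i J; rewrite iJ' /= => cU.
    have := cardsD1 j (i |: J); rewrite !inE jJ orbT cU => /addnI <-; exact: ltIJ.
  - move=> k [kJ kI ik]; exists k; split=> //; move: kJ; rewrite !inE.
    by case/andP=> _ /orP[/eqP ki|//]; rewrite ki iI' in kI.
have E : (A :\: J) :\ i = A :\: (i |: J) by rewrite setDDl setUC.
have [|[j jA]] := connected_exchange i (connectedP _ iJ) (connectedP _ iI); rewrite E.
  move=> c; exists j0 => //; split=> //; apply: (indepS (subD1set _ _)).
  exact/connectedP.
move: jA; rewrite inE => /andP[jI jA] cj.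
have [jJ|jJ] := boolP (j \in J).
  exists j => //; split=> //; apply/connectedP/(connectedS _ cj)/subsetP => k.
  by rewrite !inE; case: (k =P j) => [->|].
exists j0 => //; split=> //; apply: (indepS (subD1set _ _)).
apply/connectedP/(connectedS _ cj)/subsetP => k; rewrite !inE.
case/orP=> [/eqP ->|//]; rewrite (negbTE jJ) jA orbF andbT.
by apply: contraNneq jI => ->.
Qed.
End Cographic.

(** * The search *)

Section Search.
Variables (V : finType) (A : digraph V).
Implicit Types (B C : digraph V) (X Y : {set V}) (p q : V * V) (u v w x y : V).

Definition has_in B v : bool := [exists u, (u, v) \in B].
Definition unmet B v : bool := has_in A v && ~~ has_in B v.
Definition drop_in B w : digraph V := [set p in B | p.2 != w].
(** The ends of the augmenting paths. *)
Definition exposed B w : bool :=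
  [exists u, [&& (u, w) \in A, (u, w) \notin B & indep A ((u, w) |: B)]].
(** The edges of the augmenting paths: [x] can be met at the expense of [w]. *)
Definition exchange B x w : bool := has_in B w &&
  [exists u, [&& (u, x) \in A, (u, x) \notin B & indep A ((u, x) |: drop_in B w)]].
Definition grow B X : {set V} :=
  [set w | [|| unmet B w, w \in X | [exists x, (x \in X) && exchange B x w]]].
Definition hit B X : bool := [exists x, (x \in X) && exposed B x].
(** Breadth-first search from the unmet vertices.  It stops at the first layer that
    contains an exposed vertex, so that the exposed vertices found are those at
    the least distance. *)
Definition search B : {set V} :=
  iter #|V| (fun X => if hit B X then X else grow B X) set0.
Definition candidates B : digraph V :=
  [set p | [&& p.2 \in search B, p \in A, p \notin B & indep A (p |: B)]].
(** The singleton of the lexicographically least element, which makes the choice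
    of a candidate definable; it is empty if [C] is. *)
Definition least C : digraph V :=
  [set p in C | [forall x, [forall y, ((x, y) \in C) ==>
     ((enum_rank p.1 <= enum_rank x) && ((p.1 == x) ==> (enum_rank p.2 <= enum_rank y)))]]].
(** For empty [M] this is [B], so that [step] does nothing when the search fails. *)
Definition reassign B (M : digraph V) : digraph V :=
  [set p | (p \in M) || (p \in B) && ~~ has_in M p.2].
Definition step B : digraph V := reassign B (least (candidates B)).

Lemma least_spec C p : p \in C -> exists2 q, q \in C & least C = [set q].
Proof.
move=> pC.
(* this numbering of the pairs is the lexicographic one *)
pose key q := enum_rank q.1 * #|V| + enum_rank q.2.
case: (arg_minnP key pC) => -[x y] qC qmin; exists (x, y) => //.
have {}qC : (x, y) \in C := qC.
have lexP x' y' : (x', y') \in C -> (enum_rank x < enum_rank x') ||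
    (x == x') && (enum_rank y <= enum_rank y').
  move=> /qmin; rewrite /key /= => le.
  rewrite -(inj_eq enum_rank_inj) -(inj_eq val_inj) /=.
  have ry' : enum_rank y' < #|V| := ltn_ord _.
  case: (ltngtP (enum_rank x) (enum_rank x')) => //= [lt|eq]; last by rewrite eq leq_add2l in le.
  have lt' := leq_trans (leq_mul lt (leqnn #|V|)) (leq_addr (enum_rank y) _).
  by move: le; rewrite leqNgt (leq_trans _ lt') // mulSn addnC ltn_add2r.
apply/setP => -[a b]; rewrite !inE /=; apply/andP/eqP => [[abC /forallP/(_ x)/forallP/(_ y)]|[-> ->]].
  rewrite qC /= => /andP[ax]; have := lexP _ _ abC.
  case: eqP => [->|/eqP ne] /=.
    rewrite ltnn eqxx /= => yb by'; congr (_, _); apply/enum_rank_inj/val_inj/eqP.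
    by rewrite eqn_leq yb by'.
  by rewrite orbF ltnNge ax.
split=> //; apply/forallP => x'; apply/forallP => y'; apply/implyP => /lexP.
case: eqP => [->|_] /=; first by rewrite ltnn leqnn.
by rewrite orbF andbT => /ltnW.
Qed.

Definition partial_choice B : Prop :=
  [/\ B \subset A, (forall u u' w, (u, w) \in B -> (u', w) \in B -> u = u') & indep A B].

Lemma has_inP B v : reflect (exists u, (u, v) \in B) (has_in B v).
Proof. exact: existsP. Qed.

Lemma drop_inS B w : drop_in B w \subset B.
Proof. by apply/subsetP => p; rewrite inE => /andP[]. Qed.

Lemma reassign1 B u w : reassign B [set (u, w)] = (u, w) |: drop_in B w.
Proof.
apply/setP => -[a b]; rewrite !inE /=; congr (_ || _ && ~~ _).
apply/has_inP/eqP => [[c]|->]; first by rewrite inE => /eqP[].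
by exists u; rewrite inE.
Qed.

Lemma reassign0 B : reassign B set0 = B.
Proof.
apply/setP => p; rewrite !inE /=; case: (p \in B) => //=.
by apply/negP => /has_inP[c]; rewrite inE.
Qed.

(** Compare [e' |: drop_in B w] with the larger independent set [e |: B].  The
    former can be augmented from the latter, and not by the arc of [B] into [w],
    because [e' |: B] is dependent; so it is by [e]. *)
Lemma exchange_augment B e e' w : partial_choice B -> has_in B w ->
  e \notin B -> indep A (e |: B) -> e' \notin B -> ~~ indep A (e' |: B) ->
  indep A (e' |: drop_in B w) -> indep A (e |: (e' |: drop_in B w)).
Proof.
move=> [_ Bu _] /has_inP[f fB] eB ie e'B nie' ie'.
have sI : #|e' |: drop_in B w| <= #|B|.
  have lt : #|drop_in B w| < #|B|.
    apply/proper_card/properP; split; first exact: drop_inS.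
    by exists (f, w) => //; rewrite inE /= eqxx andbF.
  by rewrite cardsU1; case: (_ \notin _) => /=; [rewrite add1n | rewrite add0n ltnW].
have sJ : #|e |: B| = #|B|.+1 by rewrite cardsU1 eB.
have [] := indep_augment ie' ie; first by rewrite sJ ltnS.
move=> z [zJ zI iz]; move: zJ; rewrite inE => /orP[/set1P <- //|zB].
case/negP: nie'; apply: indepS iz; apply/subsetP => -[a b]; rewrite !inE.
case/orP=> [->|abB]; first by rewrite orbT.
have [bw|bw] := eqVneq b w; last by rewrite abB /= !orbT.
case: z zB zI => c d zB; rewrite !inE zB /= negb_or negbK => /andP[_ /eqP dw].
by move: zB abB; rewrite dw bw => zB abB; rewrite (Bu _ _ _ zB abB) eqxx.
Qed.

Lemma partial_choice_replace B u w : partial_choice B ->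
  (u, w) \in A -> indep A ((u, w) |: B) -> partial_choice ((u, w) |: drop_in B w).
Proof.
move=> [BA Bu iB] uA iu; split.
- by rewrite subUset sub1set uA (subset_trans (drop_inS _ _)).
- move=> a b c; rewrite !inE /= !xpair_eqE => /orP[aw|/andP[aB cw]] /orP[bw|/andP[bB wc]].
  + by case/andP: aw bw => /eqP-> _ /andP[/eqP->].
  + by rewrite (negbTE wc) andbF in aw.
  + by rewrite (negbTE cw) andbF in bw.
  + exact: Bu aB bB.
- by apply: indepS iu; apply/setUS/drop_inS.
Qed.

Lemma has_in_replace B u w v : has_in ((u, w) |: drop_in B w) v = (v == w) || has_in B v.
Proof.
apply/has_inP/orP => [[a]|[/eqP ->|/has_inP[a aB]]].
- rewrite !inE /= => /orP[/eqP[_ ->]|/andP[aB _]]; first by left.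
  by right; apply/has_inP; exists a.
- by exists u; rewrite !inE eqxx.
- by have [->|vw] := eqVneq v w; [exists u|exists a]; rewrite !inE ?eqxx // aB vw orbT.
Qed.

(** The layers of the search without the stopping rule; being iterates of a
    monotone operation they are easier to compare. *)
Definition layer B i : {set V} := iter i (grow B) set0.

Lemma growP B X w :
  reflect [\/ unmet B w, w \in X | exists2 x, x \in X & exchange B x w] (w \in grow B X).
Proof.
rewrite inE; apply: (iffP or3P) => -[]; try by [constructor 1 | constructor 2].
  by case/existsP=> x /andP[? ?]; constructor 3; exists x.
by case=> x xX xw; constructor 3; apply/existsP; exists x; rewrite xX.
Qed.

Lemma layerS B i : layer B i.+1 = grow B (layer B i).
Proof. by []. Qed.

Lemma growS B : {homo grow B : X Y / X \subset Y}.
Proof.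
move=> X Y /subsetP XY; apply/subsetP => w /growP[uw|/XY wY|[x /XY xY xw]]; apply/growP.
- by constructor 1.
- by constructor 2.
- by constructor 3; exists x.
Qed.

Lemma hitS B X Y : X \subset Y -> hit B X -> hit B Y.
Proof. by move=> /subsetP XY /existsP[x /andP[/XY xY ex]]; apply/existsP; exists x; rewrite xY. Qed.

(** An iteration with a stopping rule agrees with the plain iteration up to the
    first time that the rule applies. *)
Lemma iter_until (T : Type) (P : pred T) (g : T -> T) (x : T) n :
  exists2 k, k <= n & let r := iter n (fun t => if P t then t else g t) x in
  [/\ r = iter k g x, forall i, i < k -> ~~ P (iter i g x) & P r \/ k = n].
Proof.
elim: n => [|n [k kn [/= -> before stop]]]; first by exists 0 => //=; split=> //; right.
case: (boolP (P (iter k g x))) => Pk.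
  by exists k; [exact: leqW | rewrite Pk; split=> //; left].
have kE : k = n by case: stop => //; rewrite (negbTE Pk).
exists k.+1; rewrite ?ltnS //=; split=> //; last by right; rewrite kE.
by move=> i; rewrite ltnS leq_eqVlt => /orP[/eqP ->|/before].
Qed.

Lemma search_spec B : exists2 k, k <= #|V| &
  [/\ search B = layer B k, forall i, i < k -> ~~ hit B (layer B i) &
      hit B (search B) \/ k = #|V|].
Proof. exact: iter_until. Qed.

Lemma hit0 B : ~~ hit B set0.
Proof. by apply/existsP => -[x]; rewrite inE. Qed.

Lemma candidatesP B : hit B (search B) -> exists2 p, p \in candidates B & step B = p |: drop_in B p.2.
Proof.
case/existsP=> w /andP[ws /existsP[u /and3P[uA uB iu]]].
have [|q qC E] := @least_spec (candidates B) (u, w); first by rewrite inE ws uA uB.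
by exists q => //; rewrite /step E; case: (q) => a b; rewrite reassign1.
Qed.

Lemma step_stuck B : ~~ hit B (search B) -> step B = B.
Proof.
move=> ns; rewrite /step -[RHS]reassign0; congr reassign; apply/setP => -[u w].
rewrite !inE /=; apply/negbTE; apply: contra ns => /andP[/and4P[ws uA uB iu] _].
by apply/existsP; exists w; rewrite ws /=; apply/existsP; exists u; rewrite uA uB.
Qed.

(** Before layer [k] neither exposed vertices nor [w] occur, hence all the exchanges
    that lead up to layer [k.-1] are kept, and the predecessor of [w] on a shortest
    path, which lies in layer [k.-1], is now exposed. *)
Lemma hit_sooner B B1 w k :
  (forall v, v != w -> unmet B v -> unmet B1 v) ->
  (forall x y, ~~ exposed B x -> y != w -> exchange B x y -> exchange B1 x y) ->
  (forall x, ~~ exposed B x -> exchange B x w -> exposed B1 x) ->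
  exposed B w -> ~~ unmet B w -> w \in layer B k ->
  (forall i, i < k -> ~~ hit B (layer B i)) -> exists2 j, j < k & hit B1 (layer B1 j).
Proof.
move=> keep_unmet keep_exch exch_exp ew; case: k => [|k] nw; first by rewrite inE.
move=> wk nohit.
have out i x : i <= k -> x \in layer B i -> ~~ exposed B x.
  move=> ik xi; apply: contra (nohit i ik) => ex; by apply/existsP; exists x; rewrite xi.
have sub i : i <= k -> layer B i \subset layer B1 i.
  elim: i => [|i IH] ik; first exact: sub0set.
  have sLi := subsetP (IH (ltnW ik)).
  apply/subsetP => y yi.
  have yw : y != w by apply: contraTneq ew => <-; apply: out yi.
  case/growP: yi => [/(keep_unmet y yw) uy|/sLi yi|[x xi xy]]; apply/growP.
  - by constructor 1.
  - by constructor 2.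
  constructor 3; exists x; first exact: sLi.
  by apply: keep_exch => //; apply: out xi; apply: ltnW.
exists k => //; case/growP: wk => [|wk|[x xk xw]]; first by rewrite (negbTE nw).
  by case/negP: (out k w (leqnn k) wk); exact: ew.
apply/existsP; exists x; apply/andP; split; first exact: (subsetP (sub k (leqnn k))).
by apply: exch_exp xw; apply: out xk.
Qed.

Section Step.
Variables (B : digraph V) (u w : V).
Hypotheses (cB : partial_choice B) (uA : (u, w) \in A) (uB : (u, w) \notin B).
Hypothesis iu : indep A ((u, w) |: B).
Let B1 : digraph V := (u, w) |: drop_in B w.

Lemma exposed_target : exposed B w.
Proof. by apply/existsP; exists u; rewrite uA uB. Qed.

Lemma exchange_exposed x : ~~ exposed B x -> exchange B x w -> exposed B1 x.
Proof.
move=> nx /andP[Bw /existsP[a /and3P[aA aB ia]]]; apply/existsP; exists a; rewrite aA /=.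
have xw : x != w by apply: contraNneq nx => ->; apply: exposed_target.
apply/andP; split; first by rewrite !inE xpair_eqE (negbTE xw) andbF (negbTE aB).
rewrite /B1 setUCA; apply: exchange_augment => //.
by apply: contra nx => ia'; apply/existsP; exists a; rewrite aA aB.
Qed.

Lemma exchange_step x y : ~~ exposed B x -> y != w -> exchange B x y -> exchange B1 x y.
Proof.
move=> nx yw /andP[By /existsP[a /and3P[aA aB ia]]].
have xw : x != w by apply: contraNneq nx => ->; apply: exposed_target.
apply/andP; split; first by rewrite has_in_replace By orbT.
apply/existsP; exists a; rewrite aA /=.
apply/andP; split; first by rewrite !inE xpair_eqE (negbTE xw) andbF (negbTE aB).
have := @exchange_augment B (u, w) (a, x) y cB By uB iu aB _ ia.
have -> : ~~ indep A ((a, x) |: B).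
  by apply: contra nx => ia'; apply/existsP; exists a; rewrite aA aB.
move=> /(_ isT); apply: indepS; apply/subsetP => p; rewrite !inE.
by case/orP=> [->|/andP[/orP[->|/andP[-> _]] ->]]; rewrite ?orbT.
Qed.

Lemma unmet_step v : unmet B1 v = unmet B v && (v != w).
Proof. by rewrite /unmet has_in_replace negb_or -andbA [_ && (v != w)]andbC. Qed.

End Step.

Lemma step_choice B : partial_choice B -> partial_choice (step B).
Proof.
move=> cB; have [h|/step_stuck -> //] := boolP (hit B (search B)).
have [[u w]] := candidatesP h; rewrite inE => /and4P[_ uA uB iu] ->.
exact: partial_choice_replace.
Qed.

Definition unmets B : {set V} := [set v | unmet B v].
Definition stuck B : bool := ~~ hit B (search B).

Lemma iter_stuck B n : stuck B -> iter n step B = B.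
Proof. by move=> sB; elim: n => //= n ->; apply: step_stuck. Qed.

Lemma iter_step_choice B n : partial_choice B -> partial_choice (iter n step B).
Proof. by move=> cB; elim: n => [//|n IH]; rewrite iterS; apply: step_choice. Qed.

Lemma unmets_step B : unmets (step B) \subset unmets B.
Proof.
have [h|/step_stuck -> //] := boolP (hit B (search B)).
have [[u w]] := candidatesP h; rewrite inE => /and4P[_ uA uB iu] ->.
by apply/subsetP => v; rewrite !inE unmet_step => /andP[].
Qed.

Lemma unmets_iter B n : unmets (iter n step B) \subset unmets B.
Proof. by elim: n => //= n; apply: subset_trans (unmets_step _). Qed.

(** By induction on the distance [i] from the unmet vertices to the exposed ones:
    a step meets a new vertex or decreases this distance. *)
Lemma progress B i : partial_choice B -> hit B (layer B i) -> i <= #|V| ->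
  exists2 j, j <= i & #|unmets (iter j step B)| < #|unmets B|.
Proof.
elim/ltn_ind: i B => i IH B cB hi lei.
have [k kV [sE nohit stop]] := search_spec B.
have ki : k <= i.
  rewrite leqNgt; apply/negP => ik; by rewrite (negbTE (nohit i ik)) in hi.
have h : hit B (search B).
  case: stop => // kE; rewrite sE; move: hi; apply: hitS.
  have -> : i = k by apply/eqP; rewrite eqn_leq ki kE lei.
  by [].
have [[u w]] := candidatesP h; rewrite inE => /and4P[ws uA uB iu] sB.
have [uw|uw] := boolP (unmet B w).
  exists 1; first by apply: leq_trans ki; case: (k) sE ws => [-> | //]; rewrite inE.
  apply/proper_card/properP; split; first exact: unmets_step.
  by exists w; rewrite inE //= sB unmet_step eqxx andbF.
have keep v : v != w -> unmet B v -> unmet ((u, w) |: drop_in B w) v.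
  by move=> vw uv; rewrite unmet_step uv.
have wk : w \in layer B k by rewrite -sE; exact: ws.
have [j jk hj] := hit_sooner keep (exchange_step cB uA uB iu) (exchange_exposed cB uA uB iu)
  (exposed_target uA uB iu) uw wk nohit.
rewrite -[(u, w) |: _]sB in hj.
have ji := leq_trans jk ki.
have [j' jj lt] := IH j ji (step B) (step_choice cB) hj (leq_trans (ltnW ji) lei).
exists j'.+1; first exact: leq_ltn_trans jj ji.
by rewrite iterSr; apply: leq_trans lt (subset_leq_card (unmets_step B)).
Qed.

Lemma round_progress B : partial_choice B ->
  stuck B \/ #|unmets (iter #|V| step B)| < #|unmets B|.
Proof.
move=> cB; have [h|] := boolP (hit B (search B)); last by left.
right; have [k kV [sE _ _]] := search_spec B; rewrite sE in h.
have [j jk lt] := progress cB h kV.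
rewrite -(subnK (leq_trans jk kV)) iterD; apply: leq_trans lt.
by rewrite ltnS; apply/subset_leq_card/unmets_iter.
Qed.

Definition solve : digraph V := iter #|V| (iter #|V| step) set0.

Lemma partial_choice0 : connected A -> partial_choice set0.
Proof.
move=> cA; split=> [|a b c|]; first exact: sub0set.
  by rewrite inE.
by rewrite /indep setD0; apply/connectedP.
Qed.

Lemma solve_choice : connected A -> partial_choice solve.
Proof.
move=> cA; rewrite /solve; elim: {1}#|V| => [|n IH]; first exact: partial_choice0.
by rewrite iterS; apply: iter_step_choice.
Qed.

(** Each round that does not start stuck meets a vertex, and there are only [#|V|] of
    them; when all are met, the search does not even start. *)
Lemma solve_stuck : connected A -> stuck solve.
Proof.
move=> cA.
have H n : let B := iter n (iter #|V| step) set0 in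
    partial_choice B /\ (stuck B \/ #|unmets B| + n <= #|V|).
  elim: n => [|n [cB IH]] /=.
    by split; [exact: partial_choice0 | right; rewrite addn0 max_card].
  split; first exact: iter_step_choice.
  case: IH => [sB|le]; first by left; rewrite iter_stuck.
  have [sB|lt] := round_progress cB; first by left; rewrite iter_stuck.
  by right; rewrite addnS; apply: leq_trans le; rewrite ltn_add2r.
have [cB [//|]] := H #|V|; rewrite -/solve -[leqRHS]add0n leq_add2r leqn0 cards_eq0 => /eqP U0.
have L0 i : layer solve i = set0.
  elim: i => // i IH; rewrite layerS IH; apply/setP => v.
  have /setP/(_ v) := U0; rewrite !inE => -> /=; apply/existsP => -[x]; by rewrite inE.
rewrite /stuck; have [k _ [-> _ _]] := search_spec solve.
by rewrite L0 hit0.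
Qed.

(** The obstruction is the set [S] of the vertices found by the search, which is
    closed under exchanges.  Only the unmet vertices of [S] are not heads of arcs
    of [B], so that fewer than [#|S|] arcs of [B] enter [S], whereas a full choice
    [B'] has [#|S|] arcs into [S].  By augmentation an arc [(a, x)] of [B'] into
    [S] could be added to the arcs of [B] into [S].  Then, extending this set
    inside of [B], the arc [(a, x)] could replace an arc of [B] into a vertex
    outside of [S], contradicting that [S] is closed. *)
Lemma stuck_optimal B B' : partial_choice B -> stuck B -> unmets B != set0 ->
  B' \subset A -> indep A B' -> ~ (forall v, has_in A v -> has_in B' v).
Proof.
move=> cB sB /set0Pn[v0 uv0] B'A iB' full.
have [k kV [sE nohit stop]] := search_spec B.
(* the search has not been stopped, so that it has computed a fixed point of [grow] *)
have {stop} kE : k = #|V| by case: stop => // h; rewrite /stuck h in sB.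
set S := search B in sE sB.
have fix_S : grow B S = S.
  by rewrite sE kE; apply: fixsetK; apply: growS.
have [BA Bu iB] := cB.
pose into C : digraph V := [set p in C | p.2 \in S].
have headS p : p \in into B -> p.2 \in S by rewrite inE => /andP[].
have vS : v0 \in S by rewrite -fix_S; apply/growP; constructor 1; rewrite inE in uv0.
have SA v : v \in S -> has_in A v.
  have : S \subset [set v | has_in A v].
    rewrite sE; elim: (k) => [|i IH]; first exact: sub0set.
    apply/subsetP => x /growP[|/(subsetP IH)//|].
      by rewrite inE /unmet => /andP[].
    case=> y _ /andP[/has_inP[a aB] _].
    by rewrite inE; apply/has_inP; exists a; apply: (subsetP BA).
  by move=> /subsetP sS /sS; rewrite inE.
have cardB : #|into B| < #|S|.
  have : #|[set p.2 | p in into B]| = #|into B|.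
    apply: card_in_imset => -[a b] [c d]; rewrite !inE /= => /andP[aB _] /andP[cB' _] bd.
    by move: cB'; rewrite -bd => cB'; rewrite (Bu _ _ _ aB cB').
  move=> <-; apply/proper_card/properP; split.
    by apply/subsetP => _ /imsetP[p pB ->]; apply: headS.
  exists v0 => //; apply/imsetP => -[[a b] ab v0b]; move: uv0 ab; rewrite !inE /unmet => /andP[_ /has_inP n] /andP[ab _].
  by apply: n; exists a; rewrite v0b.
have cardB' : #|S| <= #|into B'|.
  apply: leq_trans (leq_imset_card (fun p => p.2) _).
  apply/subset_leq_card/subsetP => v vS'; have /full/has_inP[a aB] := SA v vS'.
  by apply/imsetP; exists (a, v) => //; rewrite inE aB.
have iI : indep A (into B) by apply: indepS iB; apply/subsetP => p; rewrite inE => /andP[].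
have iJ : indep A (into B') by apply: indepS iB'; apply/subsetP => p; rewrite inE => /andP[].
have [[a x] [eJ eI ie]] := indep_augment iI iJ (leq_trans cardB cardB').
have [eB' xS] : (a, x) \in B' /\ x \in S by move: eJ; rewrite inE => /andP[].
have eA : (a, x) \in A by apply: (subsetP B'A).
have eB : (a, x) \notin B by apply: contra eI => eB; rewrite inE eB.
have nx : ~~ exposed B x.
  by apply: contra sB => ex; apply/existsP; exists x; rewrite xS.
have nie : ~~ indep A ((a, x) |: B).
  by apply: contra nx => ie'; apply/existsP; exists a; rewrite eA eB.
(* [K] is a largest independent set between [e |: into B] and [e |: B]; by augmentation
   from [B] it misses a single element [f] of [e |: B] *)
pose e := (a, x).
pose P (K : digraph V) := [&& e |: into B \subset K, K \subset e |: B & indep A K].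
have P0 : P (e |: into B).
  rewrite /P subxx ie andbT; apply: setUS; by apply/subsetP => p; rewrite inE => /andP[].
case: (arg_maxnP (fun K : digraph V => #|K|) P0) => K /and3P[IK KB iK] Kmax.
have leK : #|B| <= #|K|.
  rewrite leqNgt; apply/negP => lt; have [z [zB zK iz]] := indep_augment iK iB lt.
  have := Kmax (z |: K); rewrite /P iz andbT.
  rewrite (subset_trans IK (subsetUr _ _)) subUset KB sub1set inE zB orbT /= cardsU1 zK /=.
  by move=> /(_ isT); rewrite add1n ltnn.
have /subsetPn[f feB fK] : ~~ (e |: B \subset K).
  by apply: contra nie => /indepS; apply.
have KE : K = (e |: B) :\ f.
  apply/eqP; rewrite eqEcard; apply/andP; split.
    rewrite subsetD1 KB; exact: fK.
  have := cardsD1 f (e |: B); rewrite feB cardsU1 eB !add1n => -[<-]; exact: leK.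
have fB : f \in B.
  move: feB; rewrite inE => /orP[/set1P fe|//]; case/negP: fK.
  by rewrite fe; apply: (subsetP IK); rewrite !inE eqxx.
have fS : f.2 \notin S.
  by apply: contra fK => fS; apply: (subsetP IK); rewrite !inE fB fS orbT.
case/negP: fS; rewrite -fix_S; apply/growP; constructor 3; exists x => //.
apply/andP; split; first by apply/has_inP; exists f.1; rewrite -surjective_pairing.
apply/existsP; exists a; rewrite eA eB /=; apply: indepS iK; rewrite KE.
apply/subsetP => p; rewrite !inE => /orP[/eqP ->|/andP[pB pf]]; last first.
  by rewrite pB orbT andbT; apply: contraNneq pf => ->.
by rewrite eqxx andbT; apply: contraNneq eB => ->.
Qed.
End Search.

(** * Out-branchings of acyclic digraphs *)

Definition rooted (V : finType) (A : digraph V) : bool :=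
  [exists s, [forall v, has_in A v == (v != s)]].

Definition solvable (V : finType) (A : digraph V) : bool :=
  [&& connectedb A, rooted A & ~~ [exists v, unmet A (solve A) v]].

Section Branching.
Variables (V : finType) (A : digraph V).
Implicit Types B : digraph V.
Hypothesis acA : acyclic A.

Lemma connect_arcS B : B \subset A -> subrel (connect (arc B)) (connect (arc A)).
Proof. by move=> /subsetP BA; apply: connect_sub => x y xy; apply/connect1/BA. Qed.

Lemma acyclic_arc u v : (u, v) \in A -> ~~ connect (arc A) v u.
Proof.
move=> uv; apply/negP => /connectP[p pp ul]; case/shortenP: pp ul => q pq uq _ ul.
suff: v :: q = [::] by [].
apply: acA; apply/andP; split; last exact: uq.
by rewrite /= rcons_path pq -ul.
Qed.

(** A numbering of the vertices that increases along the arcs. *)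
Definition height v : nat := #|[set u | connect (arc A) u v]|.

Lemma height_arc u v : (u, v) \in A -> height u < height v.
Proof.
move=> uv; apply/proper_card/properP; split.
  apply/subsetP => x; rewrite !inE => /connect_trans; apply; exact: connect1.
by exists v; rewrite inE ?connect0 // acyclic_arc.
Qed.

(** The last arc of a path from the root enters any vertex other than the root; an
    arc into the root would close a cycle. *)
Lemma branching_spec B : out_branching A B ->
  [/\ B \subset A, rooted A & forall v, has_in A v -> has_in B v].
Proof.
case=> BA _ [s sB].
have inB v : v != s -> has_in B v.
  move=> vs; have /connectP[p] := sB v; case/lastP: p => [|p w].
    by move=> _ /= vE; rewrite vE eqxx in vs.
  rewrite rcons_path last_rcons => /andP[_ pw] ->.
  by apply/has_inP; exists (last s p).
have sA : ~~ has_in A s.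
  apply/has_inP => -[u us]; have := acyclic_arc us.
  by rewrite (connect_arcS BA (sB u)).
split=> // [|v vA]; last by apply: inB; apply: contraTneq vA => ->.
apply/existsP; exists s; apply/forallP => v; apply/eqP.
have [->|/inB/has_inP[u uv]] := eqVneq v s; first exact: negbTE.
by apply/has_inP; exists u; apply: (subsetP BA).
Qed.

Lemma cycle_neighbours (c : seq V) v : uniq c -> 2 < size c -> v \in c -> next c v != prev c v.
Proof.
move=> uc sc vc; have [i p E] := rot_to vc.
have up : uniq (v :: p) by rewrite -E rot_uniq.
rewrite -(next_rot i uc) -(prev_rot i uc) E.
have : 2 < size (v :: p) by rewrite -E size_rot.
case: p {E} up => [|a [|b p]] // /and3P[vp ap _] _.
have -> : prev [:: v, a, b & p] v = last b p.
  rewrite prev_nth mem_head memNindex //.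
  exact: (nth_last v [:: v, a, b & p]).
rewrite /= eqxx; apply: contraNneq ap => ->; exact: mem_last.
Qed.

(** Induction along [height] shows that every vertex is reached from the root.  On
    a cycle of the underlying graph, both neighbours of a vertex of greatest height
    would be the tail of the only arc into this vertex. *)
Lemma choice_branching B : rooted A -> partial_choice A B ->
  (forall v, has_in A v -> has_in B v) -> nonsep_out_branching A B.
Proof.
case/existsP=> s /forallP sA [BA Bu iB] full.
split; last exact/connectedP.
have reach v : connect (arc B) s v.
  have [n] := ubnP (height v); elim: n v => // n IH v lt.
  have [->|vs] := eqVneq v s; first exact: connect0.
  have /full/has_inP[u uv] : has_in A v by rewrite (eqP (sA v)).
  apply: connect_trans (IH u _) (connect1 _) => //.
  by have := height_arc (subsetP BA _ uv); lia.
have ureach v : connect (uarc B) s v.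
  apply: (connect_sub _ (reach v)) => x y xy; apply: connect1.
  by rewrite uarcE [_ \in B]xy.
split=> //; last by exists s.
split; first by move=> x y; apply: connect_trans (ureach y); rewrite uarc_sym.
split=> [x y /(subsetP BA) xy|c /andP[cc uc]].
  by apply: contra (acyclic_arc xy) => /(subsetP BA) yx; apply: connect1.
rewrite leqNgt; apply/negP => sc.
case: c cc uc sc => // x0 c0; set c := x0 :: c0 => cc uc sc.
have x0c : x0 \in c by rewrite inE eqxx.
case: (arg_maxnP height x0c) => v vc vmax.
have := cycle_neighbours uc sc vc; case/eqP.
have below w : w \in c -> uarc B v w -> (w, v) \in B.
  move=> wc; rewrite uarcE => /orP[vw|//].
  by have := vmax w wc; have := height_arc (subsetP BA _ vw); lia.
apply: (Bu _ _ v); apply: below; rewrite ?mem_next ?mem_prev //.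
  exact: next_cycle.
by have := prev_cycle cc vc; rewrite !uarcE orbC.
Qed.

Lemma solvableP : solvable A -> nonsep_out_branching A (solve A).
Proof.
case/and3P=> /connectedP cA rA nu; apply: choice_branching => //; first exact: solve_choice.
move=> v vA; apply: contraNT nu => vB; apply/existsP; exists v; by rewrite /unmet vA.
Qed.

Lemma solvable_complete B : nonsep_out_branching A B -> solvable A.
Proof.
case=> /branching_spec[BA rA full] cB.
have cA : connected A by apply: connectedS cB; apply: subsetDl.
apply/and3P; split=> //; first exact/connectedP.
apply/negP => /existsP[v uv].
apply: (stuck_optimal (solve_choice cA) (solve_stuck cA) _ BA _ full).
  by apply/set0Pn; exists v; rewrite inE.
exact/connectedP.
Qed.
End Branching.

(** * Polynomial bounds *)

(** Monotonicity allows composition.  The base [n.+2] makes a single exponent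
    sufficient: constants and sums are absorbed by powers of a number that is at
    least 2. *)
Definition poly (g : nat -> nat) : Prop :=
  {homo g : m n / m <= n} /\ exists k, forall n, g n <= n.+2 ^ k.

Lemma poly_const c : poly (fun=> c).
Proof. by split=> [//|]; exists c => n; apply/ltnW/ltn_expl. Qed.

Lemma poly_id : poly id.
Proof. by split=> [//|]; exists 1 => n; rewrite expn1 leqW. Qed.

Lemma poly_add g h : poly g -> poly h -> poly (fun n => g n + h n).
Proof.
move=> [mg [k gk]] [mh [l hl]]; split=> [m n mn|].
  by rewrite leq_add ?mg ?mh.
exists (k + l).+1 => n; rewrite expnS mulSn; apply: leq_add.
  by apply: leq_trans (gk n) _; rewrite leq_exp2l ?leq_addr.
apply: leq_trans (hl n) _; apply: leq_trans (leq_pmull _ _) => //.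
by rewrite leq_exp2l ?leq_addl.
Qed.

Lemma poly_mul g h : poly g -> poly h -> poly (fun n => g n * h n).
Proof.
move=> [mg [k gk]] [mh [l hl]]; split=> [m n mn|].
  by rewrite leq_mul ?mg ?mh.
by exists (k + l) => n; rewrite expnD leq_mul.
Qed.

Lemma poly_comp g h : poly g -> poly h -> poly (fun n => g (h n)).
Proof.
move=> [mg [k gk]] [mh [l hl]]; split=> [m n mn|]; first by rewrite mg ?mh.
(* [h n + 2] is at most [n.+2 ^ l.+2], because 4 * [n.+2 ^ l] exceeds [n.+2 ^ l] by at least 3 *)
exists (l.+2 * k) => n; apply: leq_trans (gk _) _; rewrite expnM.
have le : (h n).+2 <= n.+2 ^ l.+2.
  have := hl n; have : 0 < n.+2 ^ l by rewrite expn_gt0.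
  by rewrite !expnS; set x := n.+2 ^ l; nia.
by case: k {gk} => [|k]; rewrite ?expn0 // leq_exp2r.
Qed.

Ltac prove_poly :=
  repeat first [done | apply: poly_const | apply: poly_id | apply: poly_add | apply: poly_mul].

(** * Closure properties of polynomial time *)

(** Total correctness with a time bound, as in a Hoare logic. *)
Definition halts (c : cmd) (st : store) (Q : store -> Prop) (b : nat) : Prop :=
  exists st' t, [/\ exec c st st' t, Q st' & t <= b].

Lemma halts_assign x e st (Q : store -> Prop) b :
  Q (update st x (eval st e)) -> ecost st e < b -> halts (Assign x e) st Q b.
Proof.
by move=> HQ lb; exists (update st x (eval st e)), (ecost st e).+1; split=> //; apply: ExecAssign.
Qed.

Lemma halts_seq c1 c2 st P Q b1 b2 b :
  halts c1 st P b1 -> (forall st', P st' -> halts c2 st' Q b2) ->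
  b1 + b2 < b -> halts (Seq c1 c2) st Q b.
Proof.
move=> [st1 [t1 [e1 P1 le1]]] H lb; have [st2 [t2 [e2 Q2 le2]]] := H _ P1.
exists st2, (t1 + t2).+1; split=> //; first exact: ExecSeq e1 e2.
by apply: leq_trans lb; rewrite ltnS leq_add.
Qed.

Lemma halts_let x e c v st Q b2 b :
  eval st e = v -> halts c (update st x v) Q b2 ->
  ecost st e + b2 + 1 < b -> halts (Seq (Assign x e) c) st Q b.
Proof.
move=> <- H lb.
apply: (halts_seq (P := fun s => s = update st x (eval st e)) (b1 := (ecost st e).+1)).
- exact: halts_assign.
- by move=> _ ->; apply: H.
- by lia.
Qed.

Lemma halts_sub c st (P Q : store -> Prop) b1 b2 :
  halts c st P b1 -> (forall st', P st' -> Q st') -> b1 <= b2 -> halts c st Q b2.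
Proof.
move=> [st1 [t1 [e1 P1 le1]]] H lb.
by exists st1, t1; split=> //; [apply: H | apply: leq_trans lb].
Qed.

Lemma tsize_gt0 d : 0 < tsize d. Proof. by case: d. Qed.

Lemma tsize_eval st e : tsize (eval st e) <= ecost st e.
Proof. by case: e => *; apply: leq_addr. Qed.

(** Every value that is stored has been paid for. *)
Lemma exec_tsize c st st' t x : exec c st st' t -> tsize (st' x) <= tsize (st x) + t.
Proof.
move=> ex; elim: ex x => {c st st' t}.
- move=> y e st x; rewrite /update; case: eqP => _; last exact: leq_addr.
  by have := tsize_eval st e; lia.
- by move=> c1 c2 st st1 st2 t1 t2 _ IH1 _ IH2 x; have := IH1 x; have := IH2 x; lia.
- by move=> e c1 c2 st st1 t _ _ IH x; have := IH x; lia.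
- by move=> e c1 c2 st st1 t _ _ IH x; have := IH x; lia.
- by move=> e c st st1 st2 t1 t2 _ _ IH1 _ IH2 x; have := IH1 x; have := IH2 x; lia.
- by move=> e c st _ x; lia.
Qed.

(** Programs are required to work from arbitrary contents of the work variables,
    and to leave the variables from [m] on untouched, so that they can be composed
    without clearing or renaming variables. *)
Definition computes (c : cmd) (m : nat) (f : tree -> tree) (g : nat -> nat) : Prop :=
  forall st, halts c st
    (fun st' => st' 0 = f (st 0) /\ forall y, m <= y -> st' y = st y)
    (g (tsize (st 0))).

Definition ptime (f : tree -> tree) : Prop :=
  exists c m g, [/\ poly g, 0 < m & computes c m f g].

Lemma ptime_polytime f : ptime f -> polytime f.
Proof.
move=> [c [m [g [[mg [k gk]] _ H]]]]; exists c, (3 ^ k), k => d.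
have [st' [t [ex [st0 _] le]]] := H (update (fun=> Leaf) 0 d).
exists t; first by exists st'.
apply: leq_trans le _; apply: leq_trans (gk _) _ => /=; rewrite -expnMn.
have : (tsize d).+2 <= 3 * tsize d by have := tsize_gt0 d; lia.
by case: k {gk} => [|k]; rewrite ?expn0 // leq_exp2r.
Qed.

Lemma ptime_size f : ptime f ->
  exists2 q, poly q & forall d, tsize (f d) <= q (tsize d).
Proof.
move=> [c [m [g [pg _ H]]]]; exists (fun n => n + g n).
  by apply: poly_add pg; apply: poly_id.
move=> d; have [st' [t [ex [<- _] le]]] := H (fun=> d).
by apply: leq_trans (exec_tsize 0 ex) _; rewrite leq_add2l.
Qed.

Lemma ptime_ext f g : f =1 g -> ptime f -> ptime g.
Proof.
move=> fg [c [m [h [ph m0 H]]]]; exists c, m, h; split=> // st.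
by apply: halts_sub (H st) _ (leqnn _) => st'; rewrite fg.
Qed.

Lemma update_same st x d : update st x d x = d.
Proof. by rewrite /update eqxx. Qed.

Lemma update_other st x d y : y != x -> update st x d y = st y.
Proof. by rewrite /update => /negbTE ->. Qed.

Lemma ptime_expr e (g : nat -> nat) (f : tree -> tree) :
  poly g -> (forall st, eval st e = f (st 0) /\ ecost st e <= g (tsize (st 0))) -> ptime f.
Proof.
move=> pg H; exists (Assign 0 e), 1, (fun n => g n + 1); split=> //.
  by apply: poly_add => //; apply: poly_const.
move=> st; have [ev co] := H st; apply: halts_assign; last by lia.
split=> [|y y1]; first by rewrite update_same ev.
by rewrite update_other //; lia.
Qed.

Lemma ptime_id : ptime id.
Proof.
by apply: (@ptime_expr (EVar 0) id) => [|st]; [apply: poly_id | rewrite /= addn0].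
Qed.

Lemma ptime_leaf : ptime (fun=> Leaf).
Proof.
by apply: (@ptime_expr ELeaf (fun=> 1)) => [|st //]; apply: poly_const.
Qed.

Lemma ptime_left : ptime left_child.
Proof.
apply: (@ptime_expr (ELeft (EVar 0)) (fun n => n + n)) => [|st /=].
  by apply: poly_add; apply: poly_id.
by split=> //; case: (st 0) => //= *; lia.
Qed.

Lemma ptime_right : ptime right_child.
Proof.
apply: (@ptime_expr (ERight (EVar 0)) (fun n => n + n)) => [|st /=].
  by apply: poly_add; apply: poly_id.
by split=> //; case: (st 0) => //= *; lia.
Qed.

Lemma ptime_comp f g : ptime f -> ptime g -> ptime (fun d => f (g d)).
Proof.
move=> [c1 [m1 [h1 [p1 m10 H1]]]] pg; have [q pq qP] := ptime_size pg.
case: pg => [c2 [m2 [h2 [p2 m20 H2]]]].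
exists (Seq c2 c1), (maxn m1 m2), (fun n => h2 n + h1 (q n) + 1); split.
- by do ![apply: poly_add]; [|apply: poly_comp|apply: poly_const].
- by rewrite leq_max m10.
move=> st; apply: (halts_seq (b2 := h1 (q (tsize (st 0)))) (H2 st)); last by lia.
move=> st1 [e1 e1']; apply: halts_sub (H1 st1) _ _.
  move=> st2 [-> e2']; rewrite e1; split=> // y.
  by rewrite geq_max => /andP[y1 y2]; rewrite e2' ?e1'.
by rewrite e1; apply: p1.1.
Qed.

(** The input is kept in a variable beyond the reach of both programs. *)
Lemma ptime_node f g : ptime f -> ptime g -> ptime (fun d => Node (f d) (g d)).
Proof.
move=> pf pg; have [q pq qP] := ptime_size pf; have [r pr rP] := ptime_size pg.
case: pf pg => [c1 [m1 [h1 [p1 m10 H1]]]] [c2 [m2 [h2 [p2 m20 H2]]]].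
pose m := maxn m1 m2.
have lm1 : m1 <= m by rewrite leq_maxl.
have lm2 : m2 <= m by rewrite leq_maxr.
exists (Seq (Assign m (EVar 0)) (Seq c1 (Seq (Assign m.+1 (EVar 0))
  (Seq (Assign 0 (EVar m)) (Seq c2 (Assign 0 (ENode (EVar m.+1) (EVar 0)))))))), m.+2.
exists (fun n => (n + n) + h1 n + h2 n + (q n + q n + q n) + (r n + r n) + 12); split=> //.
  by prove_poly.
move=> st; set d := st 0.
have qd := qP d; have rd := rP d.
pose b2 := (tsize (f d)).*2 + (tsize (g d)).*2 + 2.
pose b1 := b2 + h2 (tsize d) + tsize (f d) + tsize d + 5.
apply: (halts_let (b2 := h1 (tsize d) + b1 + 1) (v := d)) => //; last first.
  by rewrite /= -/d /b1 /b2 -!addnn; lia.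
apply: (halts_seq (b2 := b1) (H1 _)); last by rewrite update_other -/d; lia.
rewrite (update_other _ _ (y := 0)) -/d; last by lia.
move=> s1 [s10 s1y]; have s1m : s1 m = d by rewrite s1y // update_same.
apply: (halts_let (v := f d) (b2 := h2 (tsize d) + b2 + 3 + tsize d)) => //.
  2: by rewrite /= s10 /b1; lia.
apply: (halts_let (v := d) (b2 := h2 (tsize d) + b2 + 1)) => /=.
- by rewrite update_other ?s1m //; lia.
- 2: by rewrite update_other ?s1m //; lia.
apply: (halts_seq (b2 := b2) (H2 _)); last by rewrite update_same; lia.
move=> s2; rewrite update_same => -[s20 s2y].
have s2m : s2 m.+1 = f d by rewrite s2y 1?update_other ?update_same //; lia.
apply: halts_assign => /=; rewrite ?s2m ?s20; last by rewrite /b2; lia.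
rewrite update_same; split=> // y ym.
rewrite update_other; last by lia.
rewrite s2y; last by lia.
rewrite !update_other; [|lia|lia].
by rewrite s1y ?update_other //; lia.
Qed.

Lemma ptime_if b f g : ptime b -> ptime f -> ptime g ->
  ptime (fun d => if b d is Leaf then g d else f d).
Proof.
move=> pb; have [q pq qP] := ptime_size pb.
case: pb => [c0 [m0 [h0 [p0 m00 H0]]]].
move=> [c1 [m1 [h1 [p1 m10 H1]]]] [c2 [m2 [h2 [p2 m20 H2]]]].
pose m := maxn m0 (maxn m1 m2).
have lm0 : m0 <= m by rewrite leq_maxl.
have lm1 : m1 <= m by rewrite /m maxnCA leq_maxl.
have lm2 : m2 <= m by rewrite /m maxnA leq_maxr.
exists (Seq (Assign m (EVar 0)) (Seq c0 (Seq (Assign m.+1 (EVar 0))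
  (Seq (Assign 0 (EVar m)) (If (EVar m.+1) c1 c2))))), m.+2.
exists (fun n => (n + n) + h0 n + (h1 n + h2 n) + (q n + q n) + 12); split=> //.
  by prove_poly.
move=> st; set d := st 0; have qd := qP d.
pose b2 := tsize (b d) + h1 (tsize d) + h2 (tsize d) + 1.
pose b1 := b2 + tsize (b d) + tsize d + 5.
apply: (halts_let (b2 := h0 (tsize d) + b1 + 1) (v := d)) => //; last first.
  by rewrite /= -/d /b1 /b2; lia.
apply: (halts_seq (b2 := b1) (H0 _)); last by rewrite update_other -/d; lia.
rewrite (update_other _ _ (y := 0)) -/d; last by lia.
move=> s1 [s10 s1y]; have s1m : s1 m = d by rewrite s1y // update_same.
apply: (halts_let (v := b d) (b2 := b2 + 2 + tsize d)) => //.
  2: by rewrite /= s10 /b1; lia.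
apply: (halts_let (v := d) (b2 := b2)) => /=.
- by rewrite update_other ?s1m //; lia.
- 2: by rewrite update_other ?s1m //; lia.
set s2 := update _ _ _.
have s20 : s2 0 = d by rewrite /s2 update_same.
have s2m : s2 m.+1 = b d by rewrite /s2 1?update_other ?update_same //; lia.
have s2y y : m.+2 <= y -> s2 y = st y.
  move=> ym; rewrite /s2 !update_other; [|lia|lia].
  by rewrite s1y ?update_other //; lia.
have [bd|bd] : b d = Leaf \/ b d <> Leaf by case: (b d); [left | right].
  have [s3 [t [ex [s30 s3y] le]]] := H2 s2.
  exists s3, (ecost s2 (EVar m.+1) + t).+1; split.
  - by apply: ExecIfFalse ex; rewrite /= s2m.
  - by rewrite bd s30 s20; split=> // y ym; rewrite s3y ?s2y //; lia.
  - by rewrite /= s2m; move: le; rewrite s20 /b2; lia.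
have [s3 [t [ex [s30 s3y] le]]] := H1 s2.
exists s3, (ecost s2 (EVar m.+1) + t).+1; split.
- by apply: ExecIfTrue ex; rewrite /= s2m.
- rewrite s30 s20; split=> [|y ym]; last by rewrite s3y ?s2y //; lia.
  by case: (b d) bd.
- by rewrite /= s2m; move: le; rewrite s20 /b2; lia.
Qed.

(** * Loops over lists *)

Lemma halts_while_true e c st P Q b1 b2 b :
  eval st e <> Leaf -> halts c st P b1 ->
  (forall st', P st' -> halts (While e c) st' Q b2) ->
  ecost st e + b1 + b2 < b -> halts (While e c) st Q b.
Proof.
move=> en [st1 [t1 [e1 P1 le1]]] H lb; have [st2 [t2 [e2 Q2 le2]]] := H _ P1.
exists st2, (ecost st e + t1 + t2).+1; split=> //; first exact: ExecWhileTrue e1 e2.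
by apply: leq_trans lb; rewrite ltnS !leq_add.
Qed.

Lemma halts_while_false e c st (Q : store -> Prop) b :
  eval st e = Leaf -> Q st -> ecost st e < b -> halts (While e c) st Q b.
Proof. by move=> en HQ lb; exists st, (ecost st e).+1; split=> //; apply: ExecWhileFalse. Qed.

(** Every tree is the code of a list of trees, so that a loop over a list
    is meaningful on all inputs. *)
Fixpoint spine (d : tree) : seq tree := if d is Node x l then x :: spine l else [::].

Lemma spineK : cancel spine tree_of_seq.
Proof. by elim=> //= x _ l ->. Qed.

Lemma tree_of_seqK : cancel tree_of_seq spine.
Proof. by elim=> //= x l ->. Qed.

Lemma size_spine d : size (spine d) <= tsize d.
Proof. by elim: d => //= x _ l IH; lia. Qed.

Lemma tsize_left d : tsize (left_child d) <= tsize d.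
Proof. by case: d => //= *; lia. Qed.

Lemma tsize_right d : tsize (right_child d) <= tsize d.
Proof. by case: d => //= *; lia. Qed.

(** The body [F] of a loop receives the constant [e], the accumulator [a] and the
    current item [x] as a single tree. *)
Definition fold_step (F : tree -> tree) (e a x : tree) : tree := F (Node (Node e a) x).

Section Fold.
Variables (F : tree -> tree) (c : cmd) (m : nat) (g : nat -> nat).
Hypotheses (pg : poly g) (m0 : 0 < m) (cF : computes c m F g).

Definition fold_body : cmd :=
  Seq (Assign 0 (ENode (ENode (EVar m) (EVar m.+1)) (ELeft (EVar m.+2))))
    (Seq c (Seq (Assign m.+1 (EVar 0)) (Assign m.+2 (ERight (EVar m.+2))))).

(** [N] bounds the constant, the list and all the intermediate accumulators; the
    bound charges the cost of an iteration once more, for the last test. *)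
Lemma fold_loop N e a l st :
  st m = e -> st m.+1 = a -> st m.+2 = tree_of_seq l ->
  tsize e <= N -> tsize (tree_of_seq l) <= N ->
  (forall i, tsize (foldl (fold_step F e) a (take i l)) <= N) ->
  halts (While (EVar m.+2) fold_body) st
    (fun st' => st' m.+1 = foldl (fold_step F e) a l /\
                forall y, m.+3 <= y -> st' y = st y)
    ((size l).+1 * (g (3 * N + 2) + 20 * N + 20)).
Proof.
elim: l a st => [|x l IH] a st st0 st1 st2 eN lN aN.
  apply: halts_while_false; rewrite ?mul1n /= ?st2 //=; lia.
have aN0 := aN 0; have aN1 := aN 1; rewrite /= take0 /= in aN0 aN1.
pose xl := tree_of_seq (x :: l).
have xN : tsize x <= N by apply: leq_trans lN => /=; lia.
pose b1 := g (3 * N + 2) + (tsize (fold_step F e a x) + 2 * tsize xl) + 5 + (9 * N + 9).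
pose Q1 s := [/\ s m = e, s m.+1 = fold_step F e a x, s m.+2 = tree_of_seq l &
  forall y, m.+3 <= y -> s y = st y].
apply: (halts_while_true (P := Q1) (b1 := b1)
  (b2 := (size l).+1 * (g (3 * N + 2) + 20 * N + 20))); first by rewrite /= st2.
- apply: (halts_let (b2 := g (3 * N + 2) + (tsize (fold_step F e a x) + 2 * tsize xl) + 5)).
  + by rewrite /= st0 st1 st2.
  + apply: (halts_seq (b2 := tsize (fold_step F e a x) + 2 * tsize xl + 4) (cF _)).
    * rewrite update_same => s1 [s10 s1y].
      have sy y : m <= y -> s1 y = st y by move=> my; rewrite s1y // update_other //; lia.
      apply: (halts_let (v := fold_step F e a x) (b2 := 2 * tsize xl)) => /=.
      - by rewrite s10.
      - have sl : update s1 m.+1 (fold_step F e a x) m.+2 = xl.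
          by rewrite update_other ?sy ?st2 //; lia.
        apply: halts_assign => /=; rewrite sl; last by rewrite /xl /=; lia.
        rewrite /Q1 update_same; split=> [|||y ym].
        + by rewrite !update_other ?sy //; lia.
        + by rewrite update_other ?update_same //; lia.
        + by [].
        + by rewrite !update_other ?sy //; lia.
      - by rewrite s10 -/(fold_step F e a x); lia.
    * rewrite update_same [left_child _]/=.
      have : g (tsize (Node (Node e a) x)) <= g (3 * N + 2) by apply: pg.1 => /=; lia.
      by lia.
  + have := lN; rewrite /= st0 st1 st2 /b1 /=; lia.
- move=> s [s0 s1 s2 sy]; apply: halts_sub (IH (fold_step F e a x) s s0 s1 s2 eN _ _) _ _ => //.
  + by apply: leq_trans lN => /=; lia.
  + by move=> i; have := aN i.+1.
  + by move=> s' [r1 ry]; split=> // y ym; rewrite ry ?sy.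
- have := lN; rewrite -/xl => xlN.
  by rewrite /= st2 -/xl /b1 [(size l).+2 * _]mulSn; lia.
Qed.

End Fold.

Definition fold_tree (F : tree -> tree) (d : tree) : tree :=
  foldl (fold_step F (left_child d)) (left_child (right_child d))
    (spine (right_child (right_child d))).

Lemma ptime_fold_tree F q : ptime F -> poly q ->
  (forall d i, tsize (foldl (fold_step F (left_child d)) (left_child (right_child d))
     (take i (spine (right_child (right_child d))))) <= q (tsize d)) ->
  ptime (fold_tree F).
Proof.
move=> [c [m [g [pg m0 H]]]] pq bd.
exists (Seq (Assign m (ELeft (EVar 0))) (Seq (Assign m.+1 (ELeft (ERight (EVar 0))))
  (Seq (Assign m.+2 (ERight (ERight (EVar 0))))
  (Seq (While (EVar m.+2) (fold_body c m)) (Assign 0 (EVar m.+1)))))), m.+3.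
pose N n := n + q n.
exists (fun n => (n + 1) * (g (3 * N n + 2) + 20 * N n + 20) + (10 * N n + 20)); split=> //.
  prove_poly.
  apply: (@poly_comp g (fun n => 3 * N n + 2)) => //.
  by prove_poly.
move=> st; set d := st 0; set n := tsize d.
set e := left_child d; set a := left_child (right_child d).
set l := right_child (right_child d).
have eN : tsize e <= n := tsize_left d.
have rN : tsize (right_child d) <= n := tsize_right d.
have aN : tsize a <= n := leq_trans (tsize_left _) rN.
have lN : tsize l <= n := leq_trans (tsize_right _) rN.
pose v := foldl (fold_step F e) a (spine l).
have vN : tsize v <= q n.
  by have := bd d (size (spine l)); rewrite take_size.
have nN : n <= N n := leq_addr _ _.
pose b4 := (size (spine l)).+1 * (g (3 * N n + 2) + 20 * N n + 20).
apply: (halts_let (v := e) (b2 := b4 + q n + 7 * n + 8)) => //; last first.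
  rewrite /= -/d -/e -/n.
  have : b4 <= (n + 1) * (g (3 * N n + 2) + 20 * N n + 20).
    rewrite /b4 leq_mul2r; apply/orP; right; rewrite addn1 ltnS.
    exact: leq_trans (size_spine l) lN.
  by rewrite /N; lia.
apply: (halts_let (v := a) (b2 := b4 + q n + 3 * n + 5)) => /=.
- by rewrite update_other -/d //; lia.
- 2: by rewrite update_other -/d -/a -/n; lia.
apply: (halts_let (v := l) (b2 := b4 + q n + 2)) => /=.
- by rewrite !update_other -/d //; lia.
- 2: by rewrite !update_other -/d -/l -/n; lia.
set s := update (update (update st m e) m.+1 a) m.+2 l.
apply: (halts_seq (b2 := q n + 1) (@fold_loop F c m g pg m0 H (N n) e a (spine l) s _ _ _ _ _ _)).
- by rewrite /s update_other 1?update_other ?update_same //; lia.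
- by rewrite /s 1?update_other ?update_same //; lia.
- by rewrite /s update_same spineK.
- exact: leq_trans eN nN.
- by rewrite spineK; apply: leq_trans lN nN.
- by move=> i; apply: leq_trans (bd d i) _; rewrite leq_addl.
- 2: by rewrite /b4; lia.
move=> s' [s1 sy]; apply: halts_assign => /=; rewrite s1 -/v; last by lia.
rewrite update_same; split=> // y ym.
rewrite update_other; last by lia.
rewrite sy // /s !update_other //; lia.
Qed.

Lemma ptime_foldl F fe fa fl q : ptime F -> ptime fe -> ptime fa -> ptime fl -> poly q ->
  (forall e a l i, tsize (foldl (fold_step F e) a (take i l))
     <= q (tsize (Node e (Node a (tree_of_seq l))))) ->
  ptime (fun d => foldl (fold_step F (fe d)) (fa d) (spine (fl d))).
Proof.
move=> pF pe pa pl pq bd.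
have pt : ptime (fold_tree F).
  apply: (ptime_fold_tree pF (q := fun n => q (n + 4)) _) => [|d i].
    by apply: (@poly_comp q (fun n => n + 4)) => //; apply: poly_add; [apply: poly_id|apply: poly_const].
  apply: leq_trans (bd _ _ _ _) _; apply: pq.1; rewrite spineK.
  by case: d => [|? [|? ?]] /=; lia.
apply: (ptime_comp pt (g := fun d => Node (fe d) (Node (fa d) (fl d)))).
by do ![apply: ptime_node].
Qed.

(** If each iteration adds to the accumulator an amount that does not depend on it,
    then the growth is at most the number of iterations times this amount. *)
Lemma ptime_foldl_add F fe fa fl q : ptime F -> ptime fe -> ptime fa -> ptime fl -> poly q ->
  (forall e a x, tsize (fold_step F e a x) <= tsize a + q (tsize e + tsize x)) ->
  ptime (fun d => foldl (fold_step F (fe d)) (fa d) (spine (fl d))).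
Proof.
move=> pF pe pa pl pq st.
apply: (@ptime_foldl F fe fa fl (fun n => n + n * q n)) => //.
  by prove_poly.
move=> e a l i.
have bd s b M : tsize (tree_of_seq s) <= M ->
   tsize (foldl (fold_step F e) b s) <= tsize b + size s * q (tsize e + M).
  elim: s b => [|x s IH] b /= sM; first by lia.
  apply: leq_trans (IH _ _) _; first by lia.
  have := st e b x; have : q (tsize e + tsize x) <= q (tsize e + M) by apply: pq.1; lia.
  by rewrite mulSn; lia.
have tk : tsize (tree_of_seq (take i l)) <= tsize (tree_of_seq l).
  by elim: l i => [|x l IH] [|i] //=; have := IH i; lia.
apply: leq_trans (bd _ _ _ tk) _ => /=.
have sz : size (take i l) <= tsize (tree_of_seq l).
  by apply: leq_trans tk; rewrite -{1}(tree_of_seqK (take i l)) size_spine.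
apply: leq_add; first by lia.
by apply: leq_mul; [lia | apply: pq.1; lia].
Qed.

Lemma ptime_left_of f : ptime f -> ptime (fun d => left_child (f d)).
Proof. exact: ptime_comp ptime_left. Qed.

Lemma ptime_right_of f : ptime f -> ptime (fun d => right_child (f d)).
Proof. exact: ptime_comp ptime_right. Qed.

Definition truth (d : tree) : bool := if d is Leaf then false else true.

Lemma tree_of_boolK : cancel tree_of_bool truth.
Proof. by case. Qed.

Lemma ptime_true : ptime (fun=> tree_of_bool true).
Proof. by apply: ptime_node; apply: ptime_leaf. Qed.

Lemma ptime_ifb b f g : ptime b -> ptime f -> ptime g ->
  ptime (fun d => if truth (b d) then f d else g d).
Proof.
by move=> pb pf pg; apply: ptime_ext (ptime_if pb pf pg) => d; case: (b d).
Qed.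

Lemma ptime_truth b : ptime b -> ptime (fun d => tree_of_bool (truth (b d))).
Proof.
move=> pb; apply: ptime_ext (ptime_ifb pb ptime_true ptime_leaf) => d.
by case: (b d).
Qed.

Ltac prove_ptime := repeat first
  [ assumption | apply: ptime_id | apply: ptime_leaf | apply: ptime_true
  | apply: ptime_left_of | apply: ptime_right_of | apply: ptime_node
  | apply: ptime_truth | apply: ptime_ifb ].

Lemma foldl_cons_tree (T : Type) (f : T -> tree) a l :
  foldl (fun a x => Node (f x) a) a l = foldr Node a (rev (map f l)).
Proof.
elim: l a => //= x l IH a; rewrite IH rev_cons -cats1 foldr_cat //.
Qed.

Lemma ptime_rev f : ptime f -> ptime (fun d => tree_of_seq (rev (spine (f d)))).
Proof.
move=> pf; pose G d := Node (right_child d) (right_child (left_child d)).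
have pG : ptime G by rewrite /G; prove_ptime.
apply: ptime_ext (ptime_foldl_add (q := fun n => n + 1) pG ptime_leaf ptime_leaf pf _ _).
- by move=> d; rewrite (foldl_cons_tree id) map_id.
- by apply: poly_add; [apply: poly_id | apply: poly_const].
- by move=> e a x; rewrite /fold_step /=; lia.
Qed.

Lemma ptime_map F fe fl : ptime F -> ptime fe -> ptime fl ->
  ptime (fun d => tree_of_seq [seq F (Node (fe d) x) | x <- spine (fl d)]).
Proof.
move=> pF pe pl.
pose G d := Node (F (Node (left_child (left_child d)) (right_child d)))
  (right_child (left_child d)).
have pG : ptime G.
  by apply: ptime_node; [apply: (ptime_comp pF) | ]; prove_ptime.
have [q pq qP] := ptime_size pF.
have pr := ptime_foldl_add (q := fun n => q (n + 1) + 1) pG pe ptime_leaf pl.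
apply: ptime_ext (ptime_rev (pr _ _)).
- move=> d; rewrite (foldl_cons_tree (fun x => F (Node (fe d) x))) tree_of_seqK.
  by rewrite revK.
- apply: poly_add (poly_const _); apply: (poly_comp pq).
  by apply: poly_add; [apply: poly_id | apply: poly_const].
- move=> e a x; rewrite /fold_step /G /=.
  by have := qP (Node e x); rewrite /= !addn1; lia.
Qed.

Lemma ptime_has F fe fl : ptime F -> ptime fe -> ptime fl ->
  ptime (fun d => tree_of_bool (has (fun x => truth (F (Node (fe d) x))) (spine (fl d)))).
Proof.
move=> pF pe pl.
pose G d := if truth (right_child (left_child d)) then tree_of_bool true else
  tree_of_bool (truth (F (Node (left_child (left_child d)) (right_child d)))).
have pG : ptime G.
  by apply: ptime_ifb; [ | | apply: ptime_truth; apply: (ptime_comp pF)]; prove_ptime.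
apply: ptime_ext (ptime_foldl_add (q := fun=> 3) pG pe ptime_leaf pl _ _).
- move=> d; rewrite -[X in foldl _ X _]/(tree_of_bool false).
  set s := spine _; rewrite -[RHS]/(tree_of_bool (false || has _ s)).
  elim: s false => [|x s IH] b /=; first by rewrite orbF.
  by rewrite orbA -IH; congr foldl; rewrite /fold_step /G /= tree_of_boolK; case: b.
- exact: poly_const.
- move=> e a x; rewrite /fold_step /G /=; case: ifP => _ /=; first by lia.
  by case: truth => /=; lia.
Qed.

(** * Unary numerals *)

(** With [a] and [b] unary numerals this is a subtraction, and with [a] a list
    it gives access to the item of index [b]. *)
Definition behead_n (a b : tree) : tree := foldl (fun a _ => right_child a) a (spine b).

Lemma behead_nE a b : behead_n a b = tree_of_seq (drop (size (spine b)) (spine a)).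
Proof.
rewrite /behead_n; elim: (spine b) a => [|x s IH] a /=; first by rewrite drop0 spineK.
by rewrite IH; case: a.
Qed.

Lemma ptime_behead f g : ptime f -> ptime g -> ptime (fun d => behead_n (f d) (g d)).
Proof.
move=> pf pg; pose G d := right_child (right_child (left_child d)).
have pG : ptime G by rewrite /G; prove_ptime.
apply: ptime_ext (ptime_foldl_add (q := fun=> 0) pG ptime_leaf pf pg _ _).
- by [].
- exact: poly_const.
- by move=> e a x; rewrite addn0; apply: tsize_right.
Qed.

Definition numeral (n : nat) : tree := tree_of_seq (nseq n Leaf).

Lemma truth_behead m n : truth (behead_n (numeral m) (numeral n)) = (n < m).
Proof.
rewrite behead_nE !tree_of_seqK drop_nseq size_nseq.
by rewrite -subn_gt0; case: (m - n).
Qed.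

Lemma left_behead s n : left_child (behead_n (tree_of_seq s) (numeral n)) = nth Leaf s n.
Proof.
rewrite behead_nE !tree_of_seqK size_nseq -[n in RHS]addn0 -nth_drop.
by case: (drop n s).
Qed.

(** * Definable families *)

Inductive sort := Bool | Vertex | VSet | Arcs.

Definition den (s : sort) (V : finType) : Type :=
  match s with Bool => bool | Vertex => V | VSet => {set V} | Arcs => digraph V end.

Definition vertex_code (V : finType) (v : V) : tree := numeral (enum_rank v).

Definition code (s : sort) (V : finType) : den s V -> tree :=
  match s with
  | Bool => tree_of_bool
  | Vertex => @vertex_code V
  | VSet => fun X => tree_of_seq [seq tree_of_bool (x \in (X : {set V})) | x <- enum V]
  | Arcs => @encode V
  end.

(** A context lists the sorts of the free variables, the last one bound coming
    first; [ctx C V] is the type of their valuations. *)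
Fixpoint ctx (C : seq sort) (V : finType) : Type :=
  if C is s :: C' then (ctx C' V * den s V)%type else unit.

(** Below the values of the variables lies the list of all vertices, over which
    the quantifiers range. *)
Fixpoint ctx_code (C : seq sort) (V : finType) : ctx C V -> tree :=
  match C with
  | [::] => fun=> tree_of_seq [seq vertex_code v | v <- enum V]
  | s :: C' => fun e => Node (ctx_code e.1) (code e.2)
  end.

Definition vertex_list (C : seq sort) (d : tree) : tree := iter (size C) left_child d.

Lemma ptime_vertex_list C : ptime (vertex_list C).
Proof. by elim: C => [|s C IH]; [apply: ptime_id | apply: ptime_left_of]. Qed.

Lemma vertex_listS s C e a : vertex_list (s :: C) (Node e a) = vertex_list C e.
Proof. by rewrite /vertex_list iterSr. Qed.

Lemma tsize_vertex_list C d : tsize (vertex_list C d) <= tsize d.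
Proof. by elim: C => // s C IH; apply: leq_trans (tsize_left _) IH. Qed.

Lemma vertex_list_code C V (e : ctx C V) :
  vertex_list C (ctx_code e) = tree_of_seq [seq vertex_code v | v <- enum V].
Proof. by elim: C e => //= s C IH e; rewrite vertex_listS IH. Qed.

Definition family (C : seq sort) (s : sort) : Type := forall V : finType, ctx C V -> den s V.

Local Notation truths C := (forall V : finType, ctx C V -> bool).
Local Notation vertices C := (forall V : finType, ctx C V -> V).
Local Notation vsets C := (forall V : finType, ctx C V -> {set V}).
Local Notation digraphs C := (forall V : finType, ctx C V -> digraph V).

(** A single function must serve all vertex types, hence the quantification
    over families. *)
Definition feasible C s (f : family C s) : Prop :=
  exists2 F, ptime F & forall V e, F (ctx_code e) = code (f V e).

(** The size of the result is bounded in terms of the vertex list alone, on all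
    trees.  This is what keeps iterations of polynomial cost: the bound does not
    depend on the value from which an iteration starts. *)
Definition bfeasible C s (f : family C s) : Prop :=
  exists2 F, ptime F & (forall V e, F (ctx_code e) = code (f V e)) /\
    exists2 q, poly q & forall d, tsize (F d) <= q (tsize (vertex_list C d)).

Arguments feasible C s f : clear implicits.
Arguments bfeasible C s f : clear implicits.

Lemma bfeasibleW C s (f : family C s) :
  bfeasible C s f -> feasible C s f.
Proof. by move=> [F pF [FP _]]; exists F. Qed.

Lemma feasible_ext C s (f g : family C s) :
  feasible C s f -> (forall V e, f V e = g V e) -> feasible C s g.
Proof. by move=> [F pF FP] fg; exists F => // V e; rewrite FP fg. Qed.

Lemma bfeasible_ext C s (f g : family C s) :
  bfeasible C s f -> (forall V e, f V e = g V e) -> bfeasible C s g.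
Proof. by move=> [F pF [FP bF]] fg; exists F => //; split=> // V e; rewrite FP fg. Qed.

Lemma feasible_var C s : feasible (s :: C) s (fun V e => e.2).
Proof. by exists right_child => //; apply: ptime_right. Qed.

Lemma feasible_weaken C s s' (f : family C s) :
  feasible C s f -> feasible (s' :: C) s (fun V e => f V e.1).
Proof.
move=> [F pF FP]; exists (fun d => F (left_child d)) => [|V e].
  exact: ptime_comp pF ptime_left.
exact: FP.
Qed.

Arguments feasible_var {C s}.
Arguments feasible_weaken {C s s' f}.

Lemma feasible_false C : feasible C Bool (fun V e => false).
Proof. by exists (fun=> Leaf) => //; apply: ptime_leaf. Qed.

Lemma feasible_and C (f g : truths C) :
  feasible C Bool f -> feasible C Bool g -> feasible C Bool (fun V e => f V e && g V e).
Proof.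
move=> [F pF FP] [G pG GP].
exists (fun d => if truth (F d) then G d else Leaf) => [|V e]; first by prove_ptime.
by rewrite FP GP /= tree_of_boolK; case: (f V e).
Qed.

Lemma feasible_not C (f : truths C) :
  feasible C Bool f -> feasible C Bool (fun V e => ~~ f V e).
Proof.
move=> [F pF FP].
exists (fun d => if truth (F d) then Leaf else tree_of_bool true) => [|V e]; first by prove_ptime.
by rewrite FP /= tree_of_boolK; case: (f V e).
Qed.

Lemma feasible_or C (f g : truths C) :
  feasible C Bool f -> feasible C Bool g -> feasible C Bool (fun V e => f V e || g V e).
Proof.
move=> [F pF FP] [G pG GP].
exists (fun d => if truth (F d) then tree_of_bool true else G d) => [|V e]; first by prove_ptime.
by rewrite FP GP /= tree_of_boolK; case: (f V e).
Qed.

Lemma feasible_imply C (f g : truths C) :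
  feasible C Bool f -> feasible C Bool g -> feasible C Bool (fun V e => f V e ==> g V e).
Proof.
move=> hf hg; apply: feasible_ext (feasible_or (feasible_not hf) hg) _ => V e.
by rewrite implybE.
Qed.

Lemma feasible_iff C (f g : truths C) :
  feasible C Bool f -> feasible C Bool g -> feasible C Bool (fun V e => f V e == g V e).
Proof.
move=> hf hg; apply: feasible_ext (feasible_or (feasible_and hf hg)
  (feasible_and (feasible_not hf) (feasible_not hg))) _ => V e.
by case: (f V e) (g V e) => [] [].
Qed.

Lemma feasible_le C (x y : vertices C) :
  feasible C Vertex x -> feasible C Vertex y ->
  feasible C Bool (fun V e => enum_rank (x V e) <= enum_rank (y V e)).
Proof.
move=> [F pF FP] [G pG GP].
exists (fun d => if truth (behead_n (F d) (G d)) then Leaf else tree_of_bool true).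
  by apply: ptime_ifb; [apply: ptime_behead | |]; prove_ptime.
by move=> V e; rewrite FP GP /= truth_behead; case: ltnP.
Qed.

Lemma feasible_eq C (x y : vertices C) :
  feasible C Vertex x -> feasible C Vertex y ->
  feasible C Bool (fun V e => x V e == y V e).
Proof.
move=> hx hy; apply: feasible_ext (feasible_and (feasible_le hx hy) (feasible_le hy hx)) _.
by move=> V e; rewrite -eqn_leq (inj_eq val_inj) (inj_eq enum_rank_inj).
Qed.

Lemma nth_map_enum_rank (V : finType) (f : V -> tree) (x : V) :
  nth Leaf [seq f y | y <- enum V] (enum_rank x) = f x.
Proof.
rewrite (nth_map x) -?cardE ?ltn_ord //.
by rewrite -[nth _ _ _]/(nth x (enum V) (enum_rank x)) nth_enum_rank.
Qed.

Lemma feasible_in C (x : vertices C) (X : vsets C) :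
  feasible C Vertex x -> feasible C VSet X ->
  feasible C Bool (fun V e => x V e \in X V e).
Proof.
move=> [F pF FP] [G pG GP].
exists (fun d => left_child (behead_n (G d) (F d))).
  by apply: ptime_left_of; apply: ptime_behead.
by move=> V e; rewrite FP GP /= left_behead nth_map_enum_rank.
Qed.

Lemma feasible_arc C (x y : vertices C) (A : digraphs C) :
  feasible C Vertex x -> feasible C Vertex y -> feasible C Arcs A ->
  feasible C Bool (fun V e => (x V e, y V e) \in A V e).
Proof.
move=> [F pF FP] [G pG GP] [H pH HP].
exists (fun d => left_child (behead_n (left_child (behead_n (H d) (F d))) (G d))).
  by apply: ptime_left_of; apply: ptime_behead => //; apply: ptime_left_of; apply: ptime_behead.
by move=> V e; rewrite FP GP HP /= left_behead nth_map_enum_rank left_behead nth_map_enum_rank.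
Qed.

Lemma feasible_exists C (f : forall V : finType, ctx C V -> V -> bool) :
  feasible (Vertex :: C) Bool (fun V e => f V e.1 e.2) ->
  feasible C Bool (fun V e => [exists x, f V e x]).
Proof.
move=> [F pF FP].
exists (fun d => tree_of_bool (has (fun x => truth (F (Node d x))) (spine (vertex_list C d)))).
  by apply: ptime_has => //; [apply: ptime_id | apply: ptime_vertex_list].
move=> V e; rewrite vertex_list_code tree_of_seqK has_map /=; congr tree_of_bool.
have E x : truth (F (Node (ctx_code e) (vertex_code x))) = f V e x.
  by rewrite (FP V (e, x)) tree_of_boolK.
apply/hasP/existsP => [[x _ /= fx] | [x fx]]; exists x.
- by rewrite -E.
- by rewrite mem_enum.
- by rewrite /= E.
Qed.

Lemma feasible_forall C (f : forall V : finType, ctx C V -> V -> bool) :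
  feasible (Vertex :: C) Bool (fun V e => f V e.1 e.2) ->
  feasible C Bool (fun V e => [forall x, f V e x]).
Proof.
move=> hf; apply: feasible_ext (feasible_not (feasible_exists (f := fun V e x => ~~ f V e x) _)) _.
  exact: feasible_not.
by move=> V e; rewrite negb_exists; apply: eq_forallb => x; rewrite negbK.
Qed.

Lemma tsize_map (F : tree -> tree) K s : (forall x, tsize (F x) <= K) ->
  tsize (tree_of_seq (map F s)) <= size s * K.+1 + 1.
Proof. by move=> FK; elim: s => //= x s; have := FK x; rewrite mulSn; lia. Qed.

Definition set_tree (F : tree -> tree) (C : seq sort) (d : tree) : tree :=
  tree_of_seq [seq tree_of_bool (truth (F (Node d x))) | x <- spine (vertex_list C d)].

Lemma ptime_set_tree F C : ptime F -> ptime (set_tree F C).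
Proof.
move=> pF; apply: (@ptime_map (fun d => tree_of_bool (truth (F d))) id (vertex_list C)).
- exact: ptime_truth.
- exact: ptime_id.
- exact: ptime_vertex_list.
Qed.

Lemma tsize_set_tree F C d : tsize (set_tree F C d) <= tsize (vertex_list C d) * 4 + 1.
Proof.
apply: leq_trans (tsize_map (K := 3) _ _) _; first by move=> x; case: truth.
by rewrite leq_add2r leq_mul2r size_spine orbT.
Qed.

Lemma set_tree_code (F : tree -> tree) C (f : forall V : finType, ctx C V -> V -> bool) :
  (forall V (e : ctx (Vertex :: C) V), F (ctx_code e) = tree_of_bool (f V e.1 e.2)) ->
  forall V e, set_tree F C (ctx_code e) = tree_of_seq [seq tree_of_bool (f V e x) | x <- enum V].
Proof.
move=> FP V e; rewrite /set_tree vertex_list_code tree_of_seqK -map_comp; congr tree_of_seq.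
by apply: eq_map => x /=; rewrite (FP V (e, x)) tree_of_boolK.
Qed.

(** The result is a list of as many booleans as there are vertices. *)
Lemma bfeasible_vset C (f : forall V : finType, ctx C V -> V -> bool) :
  feasible (Vertex :: C) Bool (fun V e => f V e.1 e.2) ->
  bfeasible C VSet (fun V e => [set x | f V e x]).
Proof.
move=> [F pF FP]; exists (set_tree F C); first exact: ptime_set_tree.
split=> [V e|].
  rewrite (set_tree_code FP) /=; congr tree_of_seq.
  by apply: eq_map => x; rewrite inE.
exists (fun n => n * 4 + 1); last by move=> d; apply: tsize_set_tree.
by prove_poly.
Qed.

Lemma bfeasible_arcs C (f : forall V : finType, ctx C V -> V * V -> bool) :
  feasible (Vertex :: Vertex :: C) Bool (fun V e => f V e.1.1 (e.1.2, e.2)) ->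
  bfeasible C Arcs (fun V e => [set p | f V e p]).
Proof.
move=> [F pF FP].
pose G d := tree_of_seq [seq set_tree F (Vertex :: C) (Node d x) | x <- spine (vertex_list C d)].
have GE V e : G (ctx_code e) = encode [set p | f V e p].
  rewrite /G vertex_list_code tree_of_seqK -map_comp; congr tree_of_seq.
  apply: eq_map => x /=.
  rewrite (@set_tree_code F (Vertex :: C) (fun V e y => f V e.1 (e.2, y)) FP V (e, x)).
  by congr tree_of_seq; apply: eq_map => y; rewrite inE.
exists G.
  apply: (@ptime_map (set_tree F (Vertex :: C)) id (vertex_list C)).
  - exact: ptime_set_tree.
  - exact: ptime_id.
  - exact: ptime_vertex_list.
split=> //; exists (fun n => n * (n * 4 + 2) + 1).
  by prove_poly.
move=> d; apply: leq_trans (tsize_map (K := tsize (vertex_list C d) * 4 + 1) _ _) _.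
  by move=> x; have := tsize_set_tree F (Vertex :: C) (Node d x); rewrite vertex_listS.
by rewrite leq_add2r -addnS leq_mul2r size_spine orbT.
Qed.

(** A loop over the vertex list which ignores the vertices. *)
Lemma feasible_iter C s (f : forall V : finType, ctx C V -> den s V -> den s V)
    (x : family C s) :
  bfeasible (s :: C) s (fun V e => f V e.1 e.2) -> feasible C s x ->
  feasible C s (fun V e => iter #|V| (f V e) (x V e)).
Proof.
move=> [F pF [FP [q pq qP]]] [G pG GP].
pose H d := F (left_child d).
have pH : ptime H by apply: ptime_comp pF ptime_left.
have pI := ptime_foldl_add pH ptime_id pG (ptime_vertex_list C) pq.
eexists; first apply: pI.
  move=> e a y; rewrite /fold_step /H /=; apply: leq_trans (qP _) _.
  rewrite vertex_listS; apply: leq_trans (leq_addl _ _); apply: pq.1.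
  apply: leq_trans (leq_addr _ _).
  exact: tsize_vertex_list.
move=> V e; cbv beta; rewrite vertex_list_code tree_of_seqK GP cardE.
have -> n : iter n (f V e) (x V e) = foldl (fun y _ => f V e y) (x V e) (nseq n tt).
  by elim: n (x V e) => //= n IH y; rewrite -IH -iterSr.
elim: (enum V) (x V e) => //= v l IH y.
by rewrite -IH /fold_step /H /= (FP V (e, y)).
Qed.

(** * Feasibility of the search *)

(** The hints follow the syntax of the body of a family.  Those for the defined
    notions are keyed by the head constant: they take precedence over the
    connectives, to which the definitions would otherwise be unfolded. *)
Create HintDb feasible.

Ltac feasible_var_leaf :=
  first [refine feasible_var | refine (feasible_weaken _); feasible_var_leaf].

Ltac feasible_hyp_leaf h :=
  first [refine h | refine (feasible_weaken _); feasible_hyp_leaf h].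

#[local] Hint Extern 0 (feasible _ _ (fun V e => snd _)) => solve [feasible_var_leaf] : feasible.
#[local] Hint Extern 8 (feasible _ _ _) =>
  match goal with h : feasible _ _ _ |- _ => solve [feasible_hyp_leaf h] end : feasible.
#[local] Hint Extern 2 (feasible _ _ _) => refine (feasible_exists _) : feasible.
#[local] Hint Extern 2 (feasible _ _ _) => refine (feasible_forall _) : feasible.
#[local] Hint Extern 3 (feasible _ _ _) => refine (feasible_and _ _) : feasible.
#[local] Hint Extern 3 (feasible _ _ _) => refine (feasible_or _ _) : feasible.
#[local] Hint Extern 3 (feasible _ _ _) => refine (feasible_imply _ _) : feasible.
#[local] Hint Extern 3 (feasible _ _ _) => refine (feasible_not _) : feasible.
#[local] Hint Extern 3 (feasible _ _ _) => refine (feasible_iff _ _) : feasible.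
#[local] Hint Extern 3 (feasible _ _ _) => refine (feasible_le _ _) : feasible.
#[local] Hint Extern 3 (feasible _ _ _) => refine (feasible_eq _ _) : feasible.
#[local] Hint Extern 3 (feasible _ _ _) => refine (feasible_in _ _) : feasible.
#[local] Hint Extern 3 (feasible _ _ _) => refine (feasible_arc _ _ _) : feasible.
#[local] Hint Extern 9 (feasible _ _ _) => progress (simpl fst; simpl snd) : feasible.

Ltac prove_feasible := solve [auto 100 with feasible nocore].

Lemma feasible_vset0 C : feasible C VSet (fun V e => set0).
Proof.
apply: bfeasibleW; apply: bfeasible_ext (bfeasible_vset (feasible_false _)) _.
by move=> V e; apply/setP => x; rewrite !inE.
Qed.

Lemma feasible_arcs0 C : feasible C Arcs (fun V e => set0).
Proof.
apply: bfeasibleW.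
apply: bfeasible_ext (bfeasible_arcs (f := fun V e p => false) (feasible_false _)) _.
by move=> V e; apply/setP => x; rewrite !inE.
Qed.

Lemma feasible_has_in C (B : digraphs C) (x : vertices C) :
  feasible C Arcs B -> feasible C Vertex x ->
  feasible C Bool (fun V e => has_in (B V e) (x V e)).
Proof. rewrite /has_in => hB hx; prove_feasible. Qed.
#[local] Hint Extern 1 (feasible _ _ (fun V e => has_in _ _)) => refine (feasible_has_in _ _) : feasible.

Lemma feasible_uclosure C (B : digraphs C) :
  feasible C Arcs B -> feasible C Arcs (fun V e => uclosure (B V e)).
Proof.
move=> hB; refine (feasible_iter (C := C) (s := Arcs) _ (feasible_arcs0 C)).
refine (bfeasible_arcs (C := Arcs :: C) _); prove_feasible.
Qed.
#[local] Hint Extern 1 (feasible _ _ (fun V e => uclosure _)) => refine (feasible_uclosure _) : feasible.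

Lemma feasible_setD C (A B : digraphs C) :
  feasible C Arcs A -> feasible C Arcs B ->
  feasible C Arcs (fun V e => A V e :\: B V e).
Proof.
move=> hA hB; apply: bfeasibleW.
apply: bfeasible_ext (bfeasible_arcs (f := fun V e p =>
  ~~ ((p.1, p.2) \in B V e) && ((p.1, p.2) \in A V e)) _) _; first by prove_feasible.
by move=> V e; apply/setP => -[a b]; rewrite !inE.
Qed.
#[local] Hint Extern 1 (feasible _ _ (fun V e => _ :\: _)) => refine (feasible_setD _ _) : feasible.

Lemma feasible_add_arc C (B : digraphs C) (x y : vertices C) :
  feasible C Arcs B -> feasible C Vertex x -> feasible C Vertex y ->
  feasible C Arcs (fun V e => (x V e, y V e) |: B V e).
Proof.
move=> hB hx hy; apply: bfeasibleW.
apply: bfeasible_ext (bfeasible_arcs (f := fun V e p =>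
  (p.1 == x V e) && (p.2 == y V e) || ((p.1, p.2) \in B V e)) _) _; first by prove_feasible.
by move=> V e; apply/setP => -[a b]; rewrite !inE.
Qed.
#[local] Hint Extern 1 (feasible _ _ (fun V e => _ |: _)) => refine (feasible_add_arc _ _ _) : feasible.

Lemma feasible_drop_in C (B : digraphs C) (x : vertices C) :
  feasible C Arcs B -> feasible C Vertex x ->
  feasible C Arcs (fun V e => drop_in (B V e) (x V e)).
Proof.
move=> hB hx; apply: bfeasibleW.
apply: bfeasible_ext (bfeasible_arcs (f := fun V e p =>
  ((p.1, p.2) \in B V e) && ~~ (p.2 == x V e)) _) _; first by prove_feasible.
by move=> V e; apply/setP => -[a b]; rewrite !inE.
Qed.
#[local] Hint Extern 1 (feasible _ _ (fun V e => drop_in _ _)) => refine (feasible_drop_in _ _) : feasible.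

Lemma feasible_connectedb C (B : digraphs C) :
  feasible C Arcs B -> feasible C Bool (fun V e => connectedb (B V e)).
Proof. rewrite /connectedb => hB; prove_feasible. Qed.
#[local] Hint Extern 1 (feasible _ _ (fun V e => connectedb _)) => refine (feasible_connectedb _) : feasible.

Lemma feasible_indep C (A B : digraphs C) :
  feasible C Arcs A -> feasible C Arcs B ->
  feasible C Bool (fun V e => indep (A V e) (B V e)).
Proof. rewrite /indep => hA hB; prove_feasible. Qed.
#[local] Hint Extern 1 (feasible _ _ (fun V e => indep _ _)) => refine (feasible_indep _ _) : feasible.

Lemma feasible_unmet C (A B : digraphs C) (x : vertices C) :
  feasible C Arcs A -> feasible C Arcs B -> feasible C Vertex x ->
  feasible C Bool (fun V e => unmet (A V e) (B V e) (x V e)).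
Proof. rewrite /unmet => hA hB hx; prove_feasible. Qed.
#[local] Hint Extern 1 (feasible _ _ (fun V e => unmet _ _ _)) => refine (feasible_unmet _ _ _) : feasible.

Lemma feasible_exposed C (A B : digraphs C) (x : vertices C) :
  feasible C Arcs A -> feasible C Arcs B -> feasible C Vertex x ->
  feasible C Bool (fun V e => exposed (A V e) (B V e) (x V e)).
Proof. rewrite /exposed => hA hB hx; prove_feasible. Qed.
#[local] Hint Extern 1 (feasible _ _ (fun V e => exposed _ _ _)) => refine (feasible_exposed _ _ _) : feasible.

Lemma feasible_exchange C (A B : digraphs C) (x y : vertices C) :
  feasible C Arcs A -> feasible C Arcs B -> feasible C Vertex x -> feasible C Vertex y ->
  feasible C Bool (fun V e => exchange (A V e) (B V e) (x V e) (y V e)).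
Proof. rewrite /exchange => hA hB hx hy; prove_feasible. Qed.
#[local] Hint Extern 1 (feasible _ _ (fun V e => exchange _ _ _ _)) => refine (feasible_exchange _ _ _ _) : feasible.

Lemma feasible_hit C (A B : digraphs C) (X : vsets C) :
  feasible C Arcs A -> feasible C Arcs B -> feasible C VSet X ->
  feasible C Bool (fun V e => hit (A V e) (B V e) (X V e)).
Proof. rewrite /hit => hA hB hX; prove_feasible. Qed.
#[local] Hint Extern 1 (feasible _ _ (fun V e => hit _ _ _)) => refine (feasible_hit _ _ _) : feasible.

Lemma feasible_grow C (A B : digraphs C) (X : vsets C) :
  feasible C Arcs A -> feasible C Arcs B -> feasible C VSet X ->
  feasible C VSet (fun V e => grow (A V e) (B V e) (X V e)).
Proof.
by rewrite /grow => hA hB hX; apply: bfeasibleW; refine (bfeasible_vset _); prove_feasible.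
Qed.
#[local] Hint Extern 1 (feasible _ _ (fun V e => grow _ _ _)) => refine (feasible_grow _ _ _) : feasible.

Lemma feasible_search C (A B : digraphs C) :
  feasible C Arcs A -> feasible C Arcs B ->
  feasible C VSet (fun V e => search (A V e) (B V e)).
Proof.
move=> hA hB; refine (feasible_iter (C := C) (s := VSet) _ (feasible_vset0 C)).
apply: bfeasible_ext (bfeasible_vset (C := VSet :: C) (f := fun V e w =>
  (hit (A V e.1) (B V e.1) e.2 && (w \in (e.2 : {set V}))) ||
  (~~ hit (A V e.1) (B V e.1) e.2 && (w \in grow (A V e.1) (B V e.1) e.2))) _) _.
  prove_feasible.
by move=> V [e X]; apply/setP => w; rewrite inE /=; case: (hit _ _ _); rewrite ?orbF.
Qed.
#[local] Hint Extern 1 (feasible _ _ (fun V e => search _ _)) => refine (feasible_search _ _) : feasible.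

Lemma feasible_candidates C (A B : digraphs C) :
  feasible C Arcs A -> feasible C Arcs B ->
  feasible C Arcs (fun V e => candidates (A V e) (B V e)).
Proof.
move=> hA hB; apply: bfeasibleW.
apply: bfeasible_ext (bfeasible_arcs (f := fun V e p => [&& p.2 \in search (A V e) (B V e),
  (p.1, p.2) \in A V e, ~~ ((p.1, p.2) \in B V e) &
  indep (A V e) ((p.1, p.2) |: B V e)]) _) _; first by prove_feasible.
by move=> V e; apply/setP => -[a b]; rewrite !inE.
Qed.

Lemma feasible_least C (B : digraphs C) :
  feasible C Arcs B -> feasible C Arcs (fun V e => least (B V e)).
Proof.
move=> hB; apply: bfeasibleW.
apply: bfeasible_ext (bfeasible_arcs (f := fun V e p => ((p.1, p.2) \in B V e) &&
  [forall x, [forall y, ((x, y) \in B V e) ==> ((enum_rank p.1 <= enum_rank x) &&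
     ((p.1 == x) ==> (enum_rank p.2 <= enum_rank y)))]]) _) _; first by prove_feasible.
by move=> V e; apply/setP => -[a b]; rewrite !inE.
Qed.

Lemma feasible_reassign C (B M : digraphs C) :
  feasible C Arcs B -> feasible C Arcs M ->
  feasible C Arcs (fun V e => reassign (B V e) (M V e)).
Proof.
move=> hB hM; apply: bfeasibleW.
apply: bfeasible_ext (bfeasible_arcs (f := fun V e p => ((p.1, p.2) \in M V e) ||
  ((p.1, p.2) \in B V e) && ~~ has_in (M V e) p.2) _) _; first by prove_feasible.
by move=> V e; apply/setP => -[a b]; rewrite !inE.
Qed.

Lemma feasible_step C (A B : digraphs C) :
  feasible C Arcs A -> feasible C Arcs B ->
  feasible C Arcs (fun V e => step (A V e) (B V e)).
Proof.
by move=> hA hB; refine (feasible_reassign hB (feasible_least _)); apply: feasible_candidates.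
Qed.
#[local] Hint Extern 1 (feasible _ _ (fun V e => step _ _)) => refine (feasible_step _ _) : feasible.

(** Writing a digraph as a comprehension over pairs of vertices recomputes its
    matrix entry by entry, which bounds the size of its code. *)
Lemma bfeasible_digraph C (B : digraphs C) : feasible C Arcs B -> bfeasible C Arcs B.
Proof.
move=> hB; apply: bfeasible_ext (bfeasible_arcs (f := fun V e p => (p.1, p.2) \in B V e) _) _.
  prove_feasible.
by move=> V e; apply/setP => -[a b]; rewrite !inE.
Qed.

Lemma feasible_solve C (A : digraphs C) :
  feasible C Arcs A -> feasible C Arcs (fun V e => solve (A V e)).
Proof.
move=> hA; refine (feasible_iter (C := C) (s := Arcs) (bfeasible_digraph _) (feasible_arcs0 C)).
refine (feasible_iter (C := Arcs :: C) (s := Arcs) (bfeasible_digraph _) feasible_var).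
prove_feasible.
Qed.
#[local] Hint Extern 1 (feasible _ _ (fun V e => solve _)) => refine (feasible_solve _) : feasible.

Lemma feasible_solvable C (A : digraphs C) :
  feasible C Arcs A -> feasible C Bool (fun V e => solvable (A V e)).
Proof. rewrite /solvable /rooted => hA; prove_feasible. Qed.

(** * The algorithm and the verifier *)

(** The codes of the vertices, read off the list of rows of an adjacency matrix.
    The accumulator holds the next numeral and, in reverse order, those already
    produced. *)
Definition numerals (d : tree) : tree :=
  tree_of_seq (rev (spine (right_child (foldl (fun a _ =>
    Node (Node Leaf (left_child a)) (Node (left_child a) (right_child a))) (Node Leaf Leaf) (spine d))))).

Lemma foldl_numerals T (l : seq T) : foldl (fun a _ =>
    Node (Node Leaf (left_child a)) (Node (left_child a) (right_child a))) (Node Leaf Leaf) l =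
    Node (numeral (size l)) (tree_of_seq (rev (map numeral (iota 0 (size l))))).
Proof.
elim/last_ind: l => //= l x IH; rewrite foldl_rcons IH size_rcons.
have -> : iota 0 (size l).+1 = rcons (iota 0 (size l)) (size l) by rewrite -addn1 iotaD cats1.
by rewrite map_rcons rev_rcons.
Qed.

Lemma ptime_numerals : ptime numerals.
Proof.
pose G d := let a := right_child (left_child d) in
  Node (Node Leaf (left_child a)) (Node (left_child a) (right_child a)).
have pG : ptime G by rewrite /G; prove_ptime.
have p0 : ptime (fun=> Node Leaf Leaf) by prove_ptime.
have bd e a s : tsize (foldl (fold_step G e) a s) <=
    tsize a + size s * (tsize (left_child a) + 2 * size s + 5).
  elim: s a => [|x s IH] a /=; first by lia.
  apply: leq_trans (IH _) _; rewrite /fold_step /G /=.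
  have : tsize a <= 1 + tsize (left_child a) + tsize (right_child a) by case: a => /=; lia.
  have : tsize (left_child a) + tsize (right_child a) <= tsize a + 1 by case: a => /=; lia.
  by nia.
have pf : ptime (fun d => foldl (fold_step G Leaf) (Node Leaf Leaf) (spine d)).
  apply: (ptime_foldl (q := fun n => n + n * (n + 2 * n + 5)) pG ptime_leaf p0 ptime_id).
    by prove_poly.
  move=> e a l i; apply: leq_trans (bd _ _ _) _.
  have sz : size (take i l) <= tsize (tree_of_seq l).
    apply: leq_trans (_ : size l <= _); first by rewrite size_take_min geq_minr.
    by rewrite -{1}(tree_of_seqK l) size_spine.
  have la := tsize_left a.
  by rewrite /=; apply: leq_add; [lia | apply: leq_mul; lia].
exact: ptime_ext (ptime_rev (ptime_right_of pf)).
Qed.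

(** The valuation in which the only variable is the input digraph. *)
Definition input_ctx (d : tree) : tree := Node (numerals d) d.

Lemma input_ctxE (V : finType) (A : digraph V) :
  input_ctx (encode A) = ctx_code ((tt, A) : ctx [:: Arcs] V).
Proof.
rewrite /input_ctx /=; congr Node.
rewrite /numerals tree_of_seqK foldl_numerals /= tree_of_seqK revK size_map.
congr tree_of_seq; rewrite -cardE.
apply: (@eq_from_nth _ Leaf) => [|i]; first by rewrite size_map size_iota size_map cardE.
rewrite size_map size_iota => lti.
rewrite (nth_map 0) ?size_iota // nth_iota // add0n.
have [x _ Ex] : exists2 x : V, true & enum_rank x = Ordinal lti :> 'I_#|V|.
  by exists (enum_val (Ordinal lti)); rewrite ?enum_valK.
by have := nth_map_enum_rank (@vertex_code V) x; rewrite Ex /= => ->; rewrite /vertex_code Ex.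
Qed.

Lemma ptime_input_ctx : ptime input_ctx.
Proof. by apply: ptime_node; [apply: ptime_numerals | apply: ptime_id]. Qed.

Theorem theorem5p3 :
  exists alg ver : tree -> tree,
    [/\ polytime alg,
        nonexistence_verifier ver
      & forall (V : finType) (A : digraph V), acyclic A ->
          (exists2 B : digraph V,
             alg (encode A) = branching_answer B & nonsep_out_branching A B) \/
          (exists2 c : tree,
             alg (encode A) = certificate_answer c & accepts ver A c)].
Proof.
have hA : feasible [:: Arcs] Arcs (fun V e => e.2) := feasible_var.
have [S pS SE] := feasible_solvable hA.
have [B pB BE] := feasible_solve hA.
have pin := ptime_input_ctx.
have pSi : ptime (fun d => S (input_ctx d)) by apply: ptime_comp.
have pBi : ptime (fun d => B (input_ctx d)) by apply: ptime_comp.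
pose alg d := if truth (S (input_ctx d)) then Node (tree_of_bool true) (B (input_ctx d))
  else Node (tree_of_bool false) Leaf.
pose ver d := if truth (S (input_ctx (left_child d))) then Leaf else tree_of_bool true.
have truthS (V : finType) (A : digraph V) : truth (S (input_ctx (encode A))) = solvable A.
  by rewrite input_ctxE SE tree_of_boolK.
exists alg, ver; split.
- by apply: ptime_polytime; rewrite /alg; prove_ptime.
- split.
    by apply: ptime_polytime; apply: ptime_ifb; [exact: (ptime_comp pSi ptime_left) | |]; prove_ptime.
  move=> V A c acA; rewrite /accepts /ver /= truthS => acc [B' /(solvable_complete acA) solA].
  by rewrite solA in acc.
- move=> V A acA; rewrite /alg truthS; have [sA|nsA] := ifP; [left|right].
    exists (solve A); last exact: solvableP.
    by rewrite input_ctxE BE.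
  by exists Leaf; rewrite // /accepts /ver /= truthS nsA.
Qed.
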